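(* Suppose $L$ satisfies (1)–(3) of the context. Then for fixed $\epsilon>0$ and $h>0$ there exist $\lambda_{\epsilon,h}\in\mathbb{R}$ and $\mathbb{Z}^N$-periodic Lipschitz functions $\phi_{\epsilon,h},\bar\phi_{\epsilon,h}$ such that $$\mathcal G[\phi_{\epsilon,h}]=\phi_{\epsilon,h}+\lambda_{\epsilon,h}\qquad\text{and}\qquad\bar{\mathcal G}[\bar\phi_{\epsilon,h}]=\bar\phi_{\epsilon,h}+\lambda_{\epsilon,h}.$$ Moreover, there exists a constant $\bar C$ such that the semiconcavity moduli of $\phi_{\epsilon,h}$ and $\bar\phi_{\epsilon,h}$ are bounded by $\bar C$ for all $\epsilon$ and all sufficiently small $h$.
   Context: $\mathbb{T}^N=\mathbb{R}^N/\mathbb{Z}^N$; functions on $\mathbb{T}^N$ are identified with $\mathbb{Z}^N$-periodic functions on $\mathbb{R}^N$. The Lagrangian $L:\mathbb{R}^N\times\mathbb{R}^N\to\mathbb{R}$ is of class $C^2$, $\mathbb{Z}^N$-periodic in $x$, and satisfies: (1) $\lim_{|v|\to\infty}L(x,v)/|v|=+\infty$ uniformly in $x$; (2) the Hessian $\left(\partial^2L/\partial v_i\partial v_j\right)(x,v)$ is positive definite; (3) there are constants $C,\Gamma>0$ with $L(x+y,v-z)+L(x-y,v+z)-2L(x,v)\le C|y|^2+\Gamma|z|^2$ for all $x,y,v,z$. For $\epsilon,h>0$ and continuous $\phi:\mathbb{T}^N\to\mathbb{R}$, $$\mathcal G[\phi](x)=-\epsilon h\ln\int_{\mathbb{R}^N}e^{-\frac{hL(x,v)+\phi(x+hv)}{\epsilon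 h}}dv,\qquad \bar{\mathcal G}[\phi](x)=-\epsilon h\ln\int_{\mathbb{R}^N}e^{-\frac{hL(x-hv,v)+\phi(x-hv)}{\epsilon h}}dv.$$ The semiconcavity modulus of $u$ is bounded by $\sigma$ if $u(x+y)+u(x-y)-2u(x)\le\sigma|y|^2$ for all $x,y\in\mathbb{R}^N$. *)

(* Defs.v *)
From HB Require Import structures.
From mathcomp Require Import all_boot all_order all_algebra.
From mathcomp Require Import all_classical all_reals all_analysis.

Set Implicit Arguments.
Unset Strict Implicit.
Unset Printing Implicit Defensive.

Import Order.TTheory GRing.Theory Num.Theory.
Import numFieldNormedType.Exports.

Local Open Scope classical_set_scope.
Local Open Scope ring_scope.

Section tuple_cons.
Context {R : realType}.
Local Notation T := (measurableTypeR R).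

Definition tuple_cons n (p : T * n.-tuple T) : n.+1.-tuple T :=
  [tuple of p.1 :: p.2].

Lemma measurable_tuple_cons n : measurable_fun setT (@tuple_cons n).
Proof.
exact: (@measurable_cons _ _ _ T fst n snd measurable_fst measurable_snd).
Qed.

End tuple_cons.

Section lebesgue_cons.
Context {R : realType} (n : nat).
Local Notation T := (measurableTypeR R).
Variable m : {sigma_finite_measure set (n.-tuple T) -> \bar R}.
Local Open Scope ereal_scope.

Definition lebesgue_cons : set (n.+1.-tuple T) -> \bar R :=
  pushforward (@lebesgue_measure R \x m) (@tuple_cons R n).

Let lebesgue_cons0 : lebesgue_cons set0 = 0.
Proof. by rewrite /lebesgue_cons /pushforward preimage_set0 measure0. Qed.

Let lebesgue_cons_ge0 A : 0 <= lebesgue_cons A.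
Proof. exact: (@measure_ge0 _ _ _ (@lebesgue_measure R \x m)). Qed.

Let lebesgue_cons_sigma_additive : semi_sigma_additive lebesgue_cons.
Proof.
pose mu : {measure set (T * n.-tuple T) -> \bar R} := @lebesgue_measure R \x m.
exact: (@measure_semi_sigma_additive _ _ _
  (measure_function_pushforward__canonical__measure_function_Measure mu
    (@measurable_tuple_cons R n))).
Qed.

HB.instance Definition _ := isMeasure.Build _ _ _ lebesgue_cons
  lebesgue_cons0 lebesgue_cons_ge0 lebesgue_cons_sigma_additive.

Lemma lebesgue_consX (A : set T) (B : set (n.-tuple T)) :
  measurable A -> measurable B ->
  lebesgue_cons [set t | A (thead t) /\ B [tuple of behead t]] =
  @lebesgue_measure R A * m B.
Proof.
move=> mA mB; rewrite /lebesgue_cons /pushforward -product_measure1E//.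
congr (_ _); apply/seteqP; split=> [[x t]|[x t]] /=; rewrite /tuple_cons/= theadE.
  by move=> [Ax Bt]; split=> //; move: Bt; congr (B _); apply: val_inj.
by move=> [Ax Bt]; split=> //; move: Bt; congr (B _); apply: val_inj.
Qed.

Let lebesgue_cons_sigma_finite : sigma_finite setT lebesgue_cons.
Proof.
have /(@sigma_finiteP _ _ _ _ _) := sigma_finiteT (@lebesgue_measure R).
move=> [F [UF ndF mF]].
have /(@sigma_finiteP _ _ _ _ _) := sigma_finiteT m.
move=> [G [UG ndG mG]].
exists (fun k => [set t | F k (thead t) /\ G k [tuple of behead t]]).
  apply/esym; rewrite -subTset => t _.
  have : [set: T] (thead t) by [].
  rewrite UF => -[i _ Fi].
  have : [set: n.-tuple T] [tuple of behead t] by [].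
  rewrite UG => -[j _ Gj].
  exists (maxn i j) => //; split.
    by apply: (subsetPset _ _ (ndF i _ (leq_maxl _ _))).
  by apply: (subsetPset _ _ (ndG j _ (leq_maxr _ _))).
move=> k; split.
  have mFk : measurable ((fun t : n.+1.-tuple T => thead t) @^-1` F k).
    rewrite -[X in measurable X]setTI.
    by apply: (measurable_tnth ord0) => //; exact: (mF k).1.
  have mGk : measurable
      ((fun t : n.+1.-tuple T => [tuple of behead t]) @^-1` G k).
    rewrite -[X in measurable X]setTI.
    by apply: measurable_behead => //; exact: (mG k).1.
  exact: measurableI mFk mGk.
have [[mFk Fk] [mGk Gk]] := (mF k, mG k).
by rewrite lebesgue_consX// lte_mul_pinfty// ge0_fin_numE.
Qed.

HB.instance Definition _ := @Measure_isSigmaFinite.Build _ _ _ lebesgue_cons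
  lebesgue_cons_sigma_finite.

End lebesgue_cons.

(* Lebesgue measure on R^n, with R^n represented by [n.-tuple R] because tuples
   carry the product sigma-algebra; lebesgue_tuple_box characterizes it. *)
Fixpoint lebesgue_tuple {R : realType} (n : nat) :
    {sigma_finite_measure set (n.-tuple (measurableTypeR R)) -> \bar R} :=
  match n with
  | 0 => \d_([tuple] : 0.-tuple (measurableTypeR R))
  | n'.+1 => lebesgue_cons (lebesgue_tuple n')
  end.

Lemma measurable_tuple_box {R : realType} n
    (A : 'I_n -> set (measurableTypeR R)) :
  (forall i, measurable (A i)) ->
  measurable [set t : n.-tuple (measurableTypeR R) | forall i, A i (tnth t i)].
Proof.
move=> mA.
rewrite (_ : [set t | _] =
  \bigcap_(i in [set: 'I_n]) ((fun t => tnth t i) @^-1` A i)).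
  apply: fin_bigcap_measurable => // i _.
  rewrite -[X in measurable X]setTI.
  exact: (@measurable_tnth _ (measurableTypeR R) n i measurableT _ (mA i)).
apply/seteqP; split=> [t tA i _|t tA i]; first exact: tA.
exact: (tA i I).
Qed.

Lemma lebesgue_tuple_box {R : realType} n
    (A : 'I_n -> set (measurableTypeR R)) :
  (forall i, measurable (A i)) ->
  lebesgue_tuple n [set t | forall i, A i (tnth t i)] =
  (\prod_(i < n) @lebesgue_measure R (A i))%E.
Proof.
elim: n A => [A _|n IHn A mA].
  by rewrite big_ord0/= diracE mem_set// => -[].
rewrite big_ord_recl -IHn => [|i]; last exact: mA.
rewrite -lebesgue_consX//; last first.
  exact: (@measurable_tuple_box R n (fun i => A (lift ord0 i)) (fun i => mA _)).
congr (lebesgue_cons _ _); apply/seteqP; split=> [t tA|t [tA0 tA] i] /=.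
  split=> [|i]; first exact: tA.
  by have := tA (lift ord0 i); rewrite [in tnth t _](tuple_eta t) tnthS.
case: (unliftP ord0 i) => [j ->|->//].
by have := tA j; rewrite [in tnth t _](tuple_eta t) tnthS.
Qed.

Section definitions.
Context {R : realType} {N : nat}.
Implicit Types (x y v z : 'rV[R]_N) (L : 'rV[R]_N -> 'rV[R]_N -> R)
  (u phi : 'rV[R]_N -> R).

Definition integral_rV (f : 'rV[R]_N -> R) : R :=
  \int[lebesgue_tuple N]_t f (\row_i tnth t i).

(* Euclidean norm; the library norm `|x| on 'rV[R]_N is the maximum norm. *)
Definition enorm x : R := Num.sqrt (\sum_i x ord0 i ^+ 2).

Definition Zperiodic u :=
  forall x (k : 'rV[int]_N), u (x + map_mx intr k) = u x.

Definition semiconcave (sigma : R) u :=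
  forall x y, u (x + y) + u (x - y) - 2 * u x <= sigma * enorm y ^+ 2.

(* On a finite-dimensional V this is the usual C^1 class: the differential is
   continuous iff each of its values ['d f p w = 'D_w f p] is. *)
Definition C1 (V : normedModType R) (f : V -> R) :=
  (forall p, differentiable f p) /\ forall w, continuous ('D_w f).

Definition C2 (V : normedModType R) (f : V -> R) :=
  C1 f /\ forall w, C1 ('D_w f).

Definition superlinear L :=
  forall M : R, exists r : R, forall x v, r < enorm v -> M <= L x v / enorm v.

Definition hessian_v L x v : 'M[R]_N :=
  \matrix_(i, j) 'D_(delta_mx ord0 i) ('D_(delta_mx ord0 j) (L x)) v.

Definition posdef (H : 'M[R]_N) :=
  forall z, z != 0 -> 0 < (z *m H *m z^T) ord0 ord0.

Definition lagrangian_semiconcave L :=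
  exists C Gamma : R, [/\ 0 < C, 0 < Gamma & forall x y v z,
    L (x + y) (v - z) + L (x - y) (v + z) - 2 * L x v
      <= C * enorm y ^+ 2 + Gamma * enorm z ^+ 2].

Definition calG (eps h : R) L phi x : R :=
  - (eps * h) * ln (integral_rV (fun v =>
    expR (- ((h * L x v + phi (x + h *: v)) / (eps * h))))).

Definition calGbar (eps h : R) L phi x : R :=
  - (eps * h) * ln (integral_rV (fun v =>
    expR (- ((h * L (x - h *: v) v + phi (x - h *: v)) / (eps * h))))).

End definitions.

(* Main.v *)
(* By the Hopf-Cole transform psi = exp(-phi/(eps h)), the two equations ask for
   positive eigenfunctions, with a common eigenvalue, of the positive linear
   operators
     A psi (x) = \int e^{-L(x,v)/eps} psi(x + h v) dv,
     A' psi (x) = \int e^{-L(x - h v,v)/eps} psi(x - h v) dv.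
   Condition (3) with the velocity absorbing the whole displacement (z = y/h)
   and the Cauchy-Schwarz inequality show that -ln (A psi) is semiconcave with a
   modulus independent of psi >= 0.  For periodic functions this gives a Harnack
   inequality A psi (x) <= Lam A psi (y), which makes A contract Hilbert's
   projective metric: the normalised iterates A^n 1 converge geometrically to an
   eigenfunction.  A and A' are adjoint on the torus, so their eigenvalues agree.
   Finally, if S is the best semiconcavity modulus of phi, letting the velocity
   absorb only the fraction theta of the displacement and optimising theta gives
   S^2 <= C (Gamma + S h), whence S <= C + Gamma when h < 1. *)

Require Import Defs.
From HB Require Import structures.
From mathcomp Require Import all_boot all_order all_algebra.
From mathcomp Require Import all_classical all_reals all_analysis.
From mathcomp Require Import measurable_realfun ring lra.

Set Implicit Arguments.
Unset Strict Implicit.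
Unset Printing Implicit Defensive.

Import Order.TTheory GRing.Theory Num.Theory.
Import numFieldNormedType.Exports.

Local Open Scope classical_set_scope.
Local Open Scope ring_scope.

(** * Lebesgue measure on tuples *)

Section translation.
Context {R : realType}.
Local Notation T := (measurableTypeR R).
Local Open Scope ereal_scope.

(** The pushforward of Lebesgue measure under the shift gives every half-open interval its length,
    so by uniqueness it is Lebesgue measure itself. *)
Lemma ge0_integral_lebesgue_shift (a : R) (f : R -> \bar R) :
  measurable_fun [set: R] f -> (forall x, 0 <= f x) ->
  \int[@lebesgue_measure R]_x f (x + a)%R = \int[@lebesgue_measure R]_x f x.
Proof.
move=> mf f0.
have ms : measurable_fun setT (fun x : T => (x + a)%R : T).
  by apply: measurable_funD.
rewrite -[LHS](@ge0_integral_pushforward _ _ _ _ R _ ms _ setT f) //.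
apply: eq_measure_integral => //= A mA _; apply/esym.
apply: lebesgue_measure_unique => //= _ [[u v]] _ <-.
rewrite /pushforward.
rewrite (_ : _ @^-1` _ = `]u - a, v - a]%classic)%R; last first.
  by apply/seteqP; split => x /=; rewrite !in_itv/= ltrBlDr lerBrDr.
rewrite !lebesgue_measure_itv/= !lte_fin ltrD2r.
by case: ifP => // _; rewrite -!EFinD; congr EFin; lra.
Qed.

Lemma ge0_integral_lebesgue_tuple_cons n (f : n.+1.-tuple T -> \bar R) :
  measurable_fun setT f -> (forall t, 0 <= f t) ->
  \int[@lebesgue_tuple R n.+1]_t f t =
  \int[@lebesgue_measure R]_x \int[@lebesgue_tuple R n]_t f (tuple_cons (x, t)).
Proof.
move=> mf f0; rewrite /= /lebesgue_cons.
rewrite (ge0_integral_pushforward (@measurable_tuple_cons R n)) //.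
rewrite preimage_setT fubini_tonelli1 //=; last first.
  exact: measurableT_comp mf (@measurable_tuple_cons R n).
Qed.

Definition tuple_shift n (z : 'I_n -> R) (t : n.-tuple T) : n.-tuple T :=
  [tuple (tnth t i + z i)%R | i < n].

Lemma measurable_tuple_shift n (z : 'I_n -> R) :
  measurable_fun setT (tuple_shift z).
Proof.
apply/measurable_fun_tnthP => i.
rewrite (_ : _ \o _ = fun t : n.-tuple T => (tnth t i + z i)%R); last first.
  by apply/funext => t /=; rewrite tnth_mktuple.
by apply: measurable_funD => //; exact: measurable_tnth.
Qed.

Lemma tuple_shift_cons n (z : 'I_n.+1 -> R) x (t : n.-tuple T) :
  tuple_shift z (tuple_cons (x, t)) =
  tuple_cons ((x + z ord0)%R, tuple_shift (fun i => z (lift ord0 i)) t).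
Proof.
apply: eq_from_tnth => i; rewrite tnth_mktuple /tuple_cons /=.
by case: (unliftP ord0 i) => [j ->|->]; rewrite ?tnthS ?tnth_mktuple ?tnth0.
Qed.

(** Induction on the dimension through Tonelli: the induction hypothesis removes the shift from the
    inner integral, one-dimensional invariance from the outer one. *)
Lemma ge0_integral_tuple_shift n (z : 'I_n -> R) (f : n.-tuple T -> \bar R) :
  measurable_fun setT f -> (forall t, 0 <= f t) ->
  \int[@lebesgue_tuple R n]_t f (tuple_shift z t) =
  \int[@lebesgue_tuple R n]_t f t.
Proof.
elim: n z f => [|n IHn] z f mf f0.
  by congr (integral _ _ _); apply/funext => t; rewrite [tuple_shift _ _]tuple0
    [t in RHS]tuple0.
rewrite [LHS]ge0_integral_lebesgue_tuple_cons//; last first.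
  exact: measurableT_comp mf (measurable_tuple_shift z).
rewrite [RHS]ge0_integral_lebesgue_tuple_cons//.
under eq_integral => x _ do under eq_integral => t _ do rewrite tuple_shift_cons.
have mfc : measurable_fun setT (f \o @tuple_cons R n).
  exact: measurableT_comp mf (@measurable_tuple_cons R n).
have mfx x : measurable_fun setT (fun t => f (tuple_cons (x, t))).
  exact: measurableT_comp mfc (pair1_measurable x).
under eq_integral => x _ do
  rewrite (IHn _ (fun t => f (tuple_cons ((x + z ord0)%R, t))))//.
apply: (@ge0_integral_lebesgue_shift (z ord0)
  (fun x => \int[@lebesgue_tuple R n]_t f (tuple_cons (x, t)))).
  apply: (@measurable_fun_fubini_tonelli_F _ _ _ _ _ (lebesgue_tuple n) (f \o @tuple_cons R n)) => //.
  by move=> p; apply: f0.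
by move=> x; apply: integral_ge0.
Qed.

End translation.

Section row_norm.
Context {R : realType} {n : nat}.
Implicit Type v : 'rV[R]_n.

Lemma coord_le_norm v i : `|v ord0 i| <= `|v|.
Proof.
rewrite [leRHS]/Num.norm/= mx_normrE; apply/bigmax_geP; right => /=.
by exists (ord0, i).
Qed.

Lemma norm_row_le v (c : R) : 0 <= c -> (forall i, `|v ord0 i| <= c) -> `|v| <= c.
Proof.
move=> c0 h; rewrite [leLHS]/Num.norm/= mx_normrE; apply/bigmax_leP; split=> //.
by move=> [i j] _ /=; rewrite (ord1 i).
Qed.

End row_norm.

(** * Measurability of continuous functions *)

Section measurable_continuous.
Context {R : realType}.
Local Notation T := (measurableTypeR R).

(* [f] is the limit of its values at grid points, and these are constant on
   countably many boxes. *)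
Lemma continuous_measurable_row n (f : 'rV[R]_n -> R) : continuous f ->
  measurable_fun setT (fun t : n.-tuple T => f (\row_i tnth t i)).
Proof.
move=> cf.
pose D (k : nat) (m : 'rV[int]_n) : 'rV[R]_n := \row_i ((m ord0 i)%:~R / k.+1%:R).
pose F k (t : n.-tuple T) : 'rV[int]_n := \row_i Num.floor (k.+1%:R * tnth t i : R).
apply: (@measurable_fun_cvg _ _ _ _ (fun k t => f (D k (F k t)))).
  move=> k _ Y mY; rewrite setTI.
  rewrite (_ : _ @^-1` Y =
      \bigcup_m (if pselect (Y (f (D k m))) then F k @^-1` [set m] else set0)).
    apply: countable_bigcupT_measurable => // m.
    case: (pselect (Y (f (D k m)))) => [Ym|nYm]; last exact: measurable0.
    rewrite (_ : _ @^-1` _ = [set t : n.-tuple T | forall i,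
      [set x : R | Num.floor (k.+1%:R * x) = m ord0 i] (tnth t i)]).
      apply: (@measurable_tuple_box R n (fun i =>
        [set x : R | Num.floor (k.+1%:R * x) = m ord0 i])) => i.
      rewrite (_ : [set x | _] =
        `[(m ord0 i)%:~R / k.+1%:R, (m ord0 i + 1)%:~R / k.+1%:R[%classic).
        exact: measurable_itv.
      apply/seteqP; split=> x /=; rewrite in_itv/= ler_pdivrMr// ltr_pdivlMr//
        [x * _]mulrC.
        by move=> <-; exact: floor_itv.
      by move=> /floor_def ->.
    apply/seteqP; split=> [t /= <- i|t /= h]; first by rewrite mxE.
    by apply/rowP => i; rewrite mxE.
  apply/seteqP; split=> [t /= Yt|t /= [m _]]; last first.
    by case: pselect => //= Ym Ft; rewrite Ft.
  by exists (F k t) => //; case: pselect.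
move=> t _.
have: D k (F k t) @[k --> \oo] --> \row_i tnth t i.
  apply/cvgrPdist_le => e e0; near=> k.
  apply: norm_row_le => [|i]; first exact: ltW.
  rewrite !mxE.
  have k0 : 0 < k.+1%:R :> R by [].
  have /andP[h1 h2] := @floor_itv R (k.+1%:R * tnth t i).
  have ke : k.+1%:R^-1 <= e.
    by apply/ltW; near: k; exact: (near_infty_natSinv_lt (PosNum e0)).
  apply: le_trans ke; rewrite -[leRHS]div1r ler_pdivlMr//.
  set y := tnth t i in h1 h2 *; set z := (Num.floor _)%:~R in h1 h2 *.
  rewrite -[X in _ * X](gtr0_norm k0) -normrM mulrBl divfK ?gt_eqF//.
  rewrite [y * _]mulrC ler_norml.
  by move: h2; rewrite intrD -/z => h2; apply/andP; split; lra.
by move/(cvg_comp _ _)/(_ (cf _)).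
Unshelve. all: by end_near. Qed.

End measurable_continuous.

(** * Integration on row vectors *)

Section integral_rV_theory.
Context {R : realType} {n : nat}.
Local Notation T := (measurableTypeR R).
Implicit Types f g : 'rV[R]_n -> R.

Definition integrable_rV f :=
  (@lebesgue_tuple R n).-integrable setT (fun t => (f (\row_i tnth t i))%:E).

Lemma integrable_rV_continuous f g : continuous f -> integrable_rV g ->
  (forall v, `|f v| <= g v) -> integrable_rV f.
Proof.
move=> cf ig fg; apply: (le_integrable measurableT _ _ ig).
  by apply/measurable_EFinP; apply: continuous_measurable_row.
by move=> t _ /=; rewrite lee_fin (le_trans (fg _))// ler_norm.
Qed.

Lemma integrable_rVZ c f : integrable_rV f -> integrable_rV (fun v => c * f v).
Proof.
by move=> /(@integrableZl _ _ _ _ _ measurableT c).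
Qed.

Lemma integrable_rVD f g : integrable_rV f -> integrable_rV g ->
  integrable_rV (fun v => f v + g v).
Proof. exact: integrableD. Qed.

Lemma integral_rVD f g : integrable_rV f -> integrable_rV g ->
  integral_rV (fun v => f v + g v) = integral_rV f + integral_rV g.
Proof. exact: RintegralD. Qed.

Lemma integral_rVZ c f : integrable_rV f ->
  integral_rV (fun v => c * f v) = c * integral_rV f.
Proof. by move=> fi; exact: RintegralZl. Qed.

Lemma integral_rV0 : integral_rV (fun _ : 'rV[R]_n => 0) = 0.
Proof. by rewrite /integral_rV Rintegral_cst// mul0r. Qed.

Lemma integrable_rV0 : integrable_rV (fun _ => 0).
Proof. exact: integrable0. Qed.

Lemma integrable_rV_sum (I : Type) (r : seq I) (F : I -> 'rV[R]_n -> R) :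
  (forall i, integrable_rV (F i)) -> integrable_rV (fun v => \sum_(i <- r) F i v).
Proof.
move=> iF; elim: r => [|i r IHr].
  rewrite (_ : (fun _ => _) = (fun _ => 0)); first exact: integrable_rV0.
  by apply/funext => v; rewrite big_nil.
rewrite (_ : (fun _ => _) = (fun v => F i v + \sum_(i <- r) F i v)).
  exact: integrable_rVD.
by apply/funext => v; rewrite big_cons.
Qed.

Lemma integral_rV_sum (I : Type) (r : seq I) (F : I -> 'rV[R]_n -> R) :
  (forall i, integrable_rV (F i)) ->
  integral_rV (fun v => \sum_(i <- r) F i v) = \sum_(i <- r) integral_rV (F i).
Proof.
move=> iF; elim: r => [|i r IHr].
  rewrite big_nil (_ : (fun _ => _) = (fun _ => 0)) ?integral_rV0//.
  by apply/funext => v; rewrite big_nil.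
rewrite big_cons -IHr -integral_rVD; [|exact: iF|exact: integrable_rV_sum].
by congr integral_rV; apply/funext => v; rewrite big_cons.
Qed.

Lemma le_integral_rV f g : integrable_rV f -> integrable_rV g ->
  (forall v, f v <= g v) -> integral_rV f <= integral_rV g.
Proof. by move=> fi gi fg; apply: le_Rintegral. Qed.

Lemma integral_rV_ge0 f : (forall v, 0 <= f v) -> 0 <= integral_rV f.
Proof. by move=> f0; apply: Rintegral_ge0. Qed.

Lemma integral_rV_shift z f : continuous f -> (forall v, 0 <= f v) ->
  integral_rV (fun v => f (v + z)) = integral_rV f.
Proof.
move=> cf f0; congr fine.
rewrite -[RHS](@ge0_integral_tuple_shift R n (fun i => z ord0 i)
  (fun t => (f (\row_i tnth t i))%:E)).
- apply: eq_integral => t _; congr (f _)%:E.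
  by apply/rowP => i; rewrite !mxE tnth_mktuple.
- by apply/measurable_EFinP; apply: continuous_measurable_row.
- by move=> t; rewrite lee_fin.
Qed.

(** The cube with sides [[0, 1]] has measure one and lies in the unit ball of the maximum norm;
    nonnegativity of [f] discards the rest of the space. *)
Lemma integral_rV_ge_box f c : integrable_rV f -> (forall v, 0 <= f v) ->
  (forall v, `|v| <= 1 -> c <= f v) -> c <= integral_rV f.
Proof.
move=> fi f0 fc.
pose B := [set t : n.-tuple T | forall i, [set` `[(0 : R), 1]] (tnth t i)].
have mB : measurable B.
  by apply: (@measurable_tuple_box R n (fun=> [set` `[(0 : R), 1]])) => i.
have muB : (lebesgue_tuple n B = 1%:E)%E.
  rewrite (@lebesgue_tuple_box R n (fun=> [set` `[(0 : R), 1]]))//.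
  rewrite big1// => i _; rewrite lebesgue_measure_itv/= lte_fin ltr01.
  by rewrite -EFinB subr0.
have fB : (lebesgue_tuple n).-integrable B (EFin \o (fun t => f (\row_i tnth t i))).
  exact: integrableS fi.
have -> : c = (\int[lebesgue_tuple n]_(t in B) c)%R.
  by rewrite Rintegral_cst// [X in fine X]muB mulr1.
have h1 : (\int[lebesgue_tuple n]_(t in B) c <=
    \int[lebesgue_tuple n]_(t in B) f (\row_i tnth t i))%R.
  apply: le_Rintegral => //.
    apply/integrableP; split; first exact: measurable_cst.
    by rewrite integral_cst// [X in (_ * X)%E]muB mule1 ltry.
  move=> t Bt; apply: fc; apply: norm_row_le => // i; rewrite mxE.
  by have := Bt i; rewrite /= in_itv/= => /andP[t0 t1]; rewrite ger0_norm.
apply: le_trans h1 _.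
rewrite /integral_rV /Rintegral fine_le//.
- exact: integrable_fin_num fB.
- exact: integrable_fin_num fi.
- apply: ge0_subset_integral => //; first exact: (measurable_int _ fi).
  by move=> t _; rewrite lee_fin.
Qed.

Lemma integral_rV_dominated_cvg0 (F : nat -> 'rV[R]_n -> R) g :
  (forall k, continuous (F k)) -> integrable_rV g ->
  (forall k v, `|F k v| <= g v) -> (forall v, F k v @[k --> \oo] --> 0) ->
  integral_rV (F k) @[k --> \oo] --> 0.
Proof.
move=> cF gi Fg F0.
rewrite -integral_rV0; apply: fine_cvg.
rewrite fineK; last first.
  by apply: (@integrable_fin_num _ _ _ _ setT) => //; exact: integrable_rV0.
apply: (@dominated_cvg _ _ _ (lebesgue_tuple n) _ measurableT
  (fun k t => (F k (\row_i tnth t i))%:E) (fun=> 0%:E)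
  (fun t => (g (\row_i tnth t i))%:E)) => //.
- by move=> k; apply/measurable_EFinP; apply: continuous_measurable_row.
- by move=> t _; apply: cvg_EFin; [exact: nearW|exact: F0].
- by move=> k t _; rewrite lee_fin.
Qed.

End integral_rV_theory.

(** * Integrability of the exponential envelope *)

Section exponential_decay.
Context {R : realType}.
Local Notation T := (measurableTypeR R).

(** By symmetry the integral is twice that over the half-line, where the integrand is [a^-1] times
    the exponential density of total mass one. *)
Lemma integral_expR_abs_lty (a : R) : 0 < a ->
  (\int[@lebesgue_measure R]_x (expR (- (a * `|x|)))%:E < +oo)%E.
Proof.
move=> a0.
have cf : continuous (fun x : R => expR (- (a * `|x|))).
  move=> x; apply: continuous_comp; last exact: continuous_expR.
  by apply: cvgN; apply: cvgMr; exact: norm_continuous.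
rewrite ge0_symfun_integralT//; last first.
  by move=> x /=; rewrite normrN.
rewrite lte_mul_pinfty//.
have mf : measurable_fun setT (exponential_pdf a).
  by apply: measurable_exponential_pdf; exact: ltW.
have pdf0 (x : R) : 0 <= exponential_pdf a x by apply: exponential_pdf_ge0; exact: ltW.
have apdf0 (x : R) : 0 <= a^-1 * exponential_pdf a x.
  by rewrite mulr_ge0// invr_ge0 ltW.
apply: (@le_lt_trans _ _
    (\int[@lebesgue_measure R]_x (a^-1 * exponential_pdf a x)%:E)%E).
  apply: (@le_trans _ _ (\int[@lebesgue_measure R]_(x in [set x | (0 <= x)%R])
      (a^-1 * exponential_pdf a x)%:E)%E).
    rewrite le_eqVlt; apply/orP; left; apply/eqP; apply: eq_integral => x.
    rewrite inE/= => x0; congr EFin; rewrite /exponential_pdf patchE.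
    rewrite mem_set/= ?in_itv/= ?x0//.
    by rewrite ger0_norm// mulrA mulVf ?gt_eqF// mul1r mulNr.
  apply: ge0_subset_integral => //.
  - by rewrite -set_itvcy.
  - by apply/measurable_EFinP; apply: measurable_funM.
  - by move=> x _; rewrite lee_fin.
under eq_integral do rewrite EFinM.
rewrite ge0_integralZl//; last 3 first.
- exact/measurable_EFinP.
- by move=> x _; rewrite lee_fin.
- by rewrite lee_fin invr_ge0 ltW.
by rewrite integral_exponential_pdf// mule1 ltry.
Qed.

(** With the sum of absolute values in the exponent the envelope is a product of one-variable
    functions, so Tonelli and induction on [n] reduce it to the case of the line. *)
Lemma integrable_rV_expR_abs n (a : R) : 0 < a ->
  integrable_rV (fun v : 'rV[R]_n => expR (- (a * \sum_i `|v ord0 i|))).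
Proof.
move=> a0.
have cs m : continuous (fun v : 'rV[R]_m => \sum_i `|v ord0 i|).
  apply: continuous_big => [|i _ v]; first exact: add_continuous.
  apply: (@continuous_comp _ _ _ (fun v : 'rV[R]_m => v ord0 i) Num.norm).
    exact: coord_continuous.
  exact: norm_continuous.
have cf m : continuous (fun v : 'rV[R]_m => expR (- (a * \sum_i `|v ord0 i|))).
  have ce : continuous (fun y : R => expR (- (a * y))).
    move=> y; apply: continuous_comp; last exact: continuous_expR.
    by apply: cvgN; apply: cvgMr; exact: cvg_id.
  move=> v.
  apply: (@continuous_comp _ _ _ (fun v : 'rV[R]_m => \sum_i `|v ord0 i|)
    (fun y : R => expR (- (a * y)))); [exact: cs|exact: ce].
apply/integrableP; split.
  by apply/measurable_EFinP; apply: (continuous_measurable_row (@cf _)).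
under eq_integral => t _ do rewrite /= ger0_norm ?expR_ge0//.
elim: n => [|n IHn].
  rewrite integral_dirac//; last first.
    by apply/measurable_EFinP; apply: (continuous_measurable_row (@cf _)).
  by rewrite [X in (X * _)%E]diracT mul1e ltry.
rewrite ge0_integral_lebesgue_tuple_cons; last 2 first.
- by apply/measurable_EFinP; apply: (continuous_measurable_row (@cf _)).
- by move=> t; rewrite lee_fin expR_ge0.
have E x (t : n.-tuple T) :
    (expR (- (a * \sum_i `|(\row_i tnth (tuple_cons (x, t)) i) ord0 i|)))%:E =
    ((expR (- (a * `|x|)))%:E *
     (expR (- (a * \sum_i `|(\row_i tnth t i) ord0 i|)))%:E)%E.
  rewrite -EFinM -expRD big_ord_recl mxE tnth0/= mulrDr opprD.
  congr (expR (_ - _ * _))%:E; apply: eq_bigr => i _.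
  by rewrite !mxE tnthS.
have E2 x : (\int[@lebesgue_tuple R n]_t
    (expR (- (a * \sum_i `|(\row_i tnth (tuple_cons (x, t)) i) ord0 i|)))%:E =
    (expR (- (a * `|x|)))%:E * \int[@lebesgue_tuple R n]_t
    (expR (- (a * \sum_i `|(\row_i tnth t i) ord0 i|)))%:E)%E.
  under eq_integral => t _ do rewrite E.
  apply: ge0_integralZl => //.
  by apply/measurable_EFinP; apply: (continuous_measurable_row (@cf _)).
under eq_integral => x _ do rewrite E2.
set c := (\int[lebesgue_tuple n]_t _)%E in IHn *.
have c0 : (0 <= c)%E by apply: integral_ge0 => t _; rewrite lee_fin expR_ge0.
have <- : (fine c)%:E = c by rewrite fineK// ge0_fin_numE.
rewrite ge0_integralZr//; last 2 first.
- apply/measurable_EFinP; apply: continuous_measurable_fun.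
  move=> x; apply: continuous_comp; last exact: continuous_expR.
  by apply: cvgN; apply: cvgMr; exact: norm_continuous.
- by rewrite lee_fin fine_ge0.
rewrite muleC lte_mul_pinfty// ?lee_fin ?fine_ge0//.
exact: integral_expR_abs_lty.
Qed.

End exponential_decay.

(** * Positive operators with a Harnack inequality *)

Section geometric_sequence.
Context {R : realType}.
Implicit Types (u : nat -> R) (K q : R).

(** With [t n] the sum of all step bounds from [n] on, [u n - t n] increases and [u n + t n]
    decreases. The limit is the supremum of the lower endpoints of these nested intervals. *)
Lemma geometric_steps_bound u K q : 0 <= q -> q < 1 ->
  (forall n, `|u n.+1 - u n| <= K * q ^+ n) ->
  exists l, forall n, `|u n - l| <= K * q ^+ n / (1 - q).
Proof.
move=> q0 q1 uq.
have K0 : 0 <= K by have := le_trans (normr_ge0 _) (uq 0); rewrite expr0 mulr1.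
have q1' : 0 < 1 - q by rewrite subr_gt0.
pose t n := K * q ^+ n / (1 - q).
have t0 n : 0 <= t n by rewrite divr_ge0 ?mulr_ge0 ?exprn_ge0// ltW.
have tS n : t n - t n.+1 = K * q ^+ n.
  by rewrite /t exprS; field; rewrite gt_eqF.
have lo : {homo (fun n => u n - t n) : m n / (m <= n)%N >-> m <= n}.
  apply: homo_leq => [//|x y z|n]; first exact: le_trans.
  by have := uq n; rewrite ler_norml -tS => /andP[h _]; lra.
have hi : {homo (fun n => u n + t n) : m n / (m <= n)%N >-> n <= m}.
  apply: (@homo_leq _ _ (fun x y => y <= x)) => [//|x y z yx zy|n].
    exact: le_trans zy yx.
  by have := uq n; rewrite ler_norml -tS => /andP[_ h]; lra.
have lohi m n : u m - t m <= u n + t n.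
  have h1 := lo _ _ (leq_maxl m n); have h2 := hi _ _ (leq_maxr m n).
  have h3 := t0 (maxn m n); lra.
exists (sup (range (fun n => u n - t n))) => n.
have h1 : u n - t n <= sup (range (fun n => u n - t n)).
  apply: ub_le_sup; last by exists n.
  by exists (u 0 + t 0) => _ [m _ <-].
have h2 : sup (range (fun n => u n - t n)) <= u n + t n.
  apply: ge_sup; first by exists (u 0 - t 0); exists 0.
  by move=> _ [m _ <-].
by rewrite ler_norml -/(t n); apply/andP; split; lra.
Qed.

Lemma geometric_bound_cvg u l K q : 0 <= q -> q < 1 ->
  (forall n, `|u n - l| <= K * q ^+ n / (1 - q)) -> u n @[n --> \oo] --> l.
Proof.
move=> q0 q1 ul.
have h : K * q ^+ n / (1 - q) @[n --> \oo] --> (0 : R).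
  rewrite -[X in _ --> X](mul0r (1 - q)^-1); apply: cvgMl.
  rewrite -[X in _ --> X](mulr0 K); apply: cvgMr.
  by apply: cvg_expr; rewrite ger0_norm.
apply/subr_cvg0/norm_cvg0P.
apply: (squeeze_cvgr _ (cvg_cst 0) h).
by near=> n; rewrite normr_ge0/=; exact: ul.
Unshelve. all: by end_near. Qed.

End geometric_sequence.

Section harnack_operator.
Context {R : realType} {X : Type}.
(** [C] will be the class of continuous periodic functions. [CA] is asked for positive functions
    only, because continuity of [A f] will come from a Lipschitz bound on [- ln (A f)]. *)
Variables (x0 : X) (C : (X -> R) -> Prop) (A : (X -> R) -> X -> R) (Lam : R).
Hypothesis C1 : C (fun=> 1).
Hypothesis Clin : forall f g a, C f -> C g -> C (fun x => f x + a * g x).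
Hypothesis Climit : forall (f_ : nat -> X -> R) f, (forall n, C (f_ n)) ->
  (forall e, 0 < e -> exists n, forall x, `|f_ n x - f x| <= e) -> C f.
Hypothesis Alin : forall f g a, C f -> C g ->
  forall x, A (fun x => f x + a * g x) x = A f x + a * A g x.
Hypothesis Age0 : forall f, C f -> (forall x, 0 <= f x) -> forall x, 0 <= A f x.
Hypothesis Aharnack : forall f, C f -> (forall x, 0 <= f x) ->
  forall x y, A f x <= Lam * A f y.
Hypothesis CA : forall f, C f -> (forall x, 0 < f x) -> C (A f).
Hypothesis A1_gt0 : forall x, 0 < A (fun=> 1) x.

Let Lam1 : 1 <= Lam.
Proof.
have := Aharnack C1 (fun=> ler01) x0 x0.
by rewrite -{1}[A _ _]mul1r ler_pM2r.
Qed.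

Let Lam0 : 0 < Lam. Proof. exact: lt_le_trans Lam1. Qed.

Let A_le f g : C f -> C g -> (forall x, f x <= g x) -> forall x, A f x <= A g x.
Proof.
move=> Cf Cg fg x; rewrite -subr_ge0 -mulN1r -Alin//.
by apply: Age0 => [|y]; [exact: Clin|rewrite mulN1r subr_ge0].
Qed.

Let A_cst c x : A (fun=> c) x = c * A (fun=> 1) x.
Proof.
rewrite (_ : (fun=> c) = (fun _ : X => 1 + (c - 1) * 1)).
  by rewrite Alin// mulrBl mul1r addrC subrK.
by apply/funext => y; rewrite mulr1 addrC subrK.
Qed.

Let C_cst c : C (fun=> c).
Proof.
rewrite (_ : (fun=> c) = (fun _ : X => 1 + (c - 1) * 1)); first exact: Clin.
by apply/funext => y; rewrite mulr1 addrC subrK.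
Qed.

Let CZ c f : C f -> C (fun x => c * f x).
Proof.
move=> Cf; rewrite (_ : (fun x => c * f x) = (fun x => 0 + c * f x)).
  exact: Clin.
by apply/funext => y; rewrite add0r.
Qed.

Let AZ c f x : C f -> A (fun x => c * f x) x = c * A f x.
Proof.
move=> Cf; rewrite (_ : (fun x => c * f x) = (fun x => 0 + c * f x)).
  by rewrite Alin// A_cst mul0r add0r.
by apply/funext => y; rewrite add0r.
Qed.

(** Since [X] carries no compactness, positivity of the iterates is propagated as a uniform lower
    bound; Harnack makes the new bound uniform as well. *)
Let A_gt0 f c : C f -> 0 < c -> (forall x, c <= f x) ->
  forall x, c * A (fun=> 1) x0 / Lam <= A f x.
Proof.
move=> Cf c0 cf x; apply: (@le_trans _ _ (c * A (fun=> 1) x)).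
  by rewrite -mulrA ler_pM2l// ler_pdivrMr// mulrC Aharnack.
by rewrite -A_cst A_le.
Qed.

Let psi n := iter n A (fun=> 1).

Let psi_C n : C (psi n) /\ exists c, 0 < c /\ forall x, c <= psi n x.
Proof.
elim: n => [|n [Cn [c [c0 cn]]]]; first by split=> //; exists 1.
split; first by apply: CA => // x; exact: lt_le_trans (cn x).
exists (c * A (fun=> 1) x0 / Lam); split; first by rewrite divr_gt0 ?mulr_gt0.
exact: (A_gt0 Cn c0 cn).
Qed.

Let Cpsi n : C (psi n) := (psi_C n).1.

Let psi_gt0 n x : 0 < psi n x.
Proof. by have [_ [c [c0 h]]] := psi_C n; exact: lt_le_trans (h x). Qed.

Let psi_harnack n x y : psi n x <= Lam * psi n y.
Proof.
case: n => [|n]; first by rewrite /psi/= mulr1.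
by apply: Aharnack => // z; exact: ltW.
Qed.

Let del := (Lam ^+ 2)^-1.

(* Birkhoff's contraction: because of this lower bound, the interval [ab n] of
   values of [psi n.+1 / psi n] shrinks by the factor [1 - del] at each step. *)
Let A_comparable h g : C h -> C g -> (forall x, 0 <= h x) ->
  (forall x, 0 <= g x) -> (forall x, 0 < A g x) ->
  forall x, del * (A h x0 / A g x0) * A g x <= A h x.
Proof.
move=> Ch Cg h0 g0 Ag0 x.
have q0 : 0 <= A h x0 / A g x0 by rewrite divr_ge0 ?Age0// ltW.
have h1 : A h x0 <= Lam * A h x by exact: Aharnack.
have h2 : A g x <= Lam * A g x0 by exact: Aharnack.
rewrite /del -mulrA mulrC ler_pdivrMr ?exprn_gt0//.
apply: (@le_trans _ _ (A h x0 / A g x0 * (Lam * A g x0))).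
  by rewrite ler_wpM2l.
by rewrite mulrCA divfK ?gt_eqF// expr2 [leRHS]mulrCA ler_pM2l// mulrC.
Qed.

Let rho n := psi n.+1 x0 / psi n x0.

(** Each interval is the previous one shrunk by the factor [1 - del] towards [rho n], taken at the
    new index because [A] has been applied once more. The initial endpoints come from Harnack for
    [A 1]. *)
Let Fixpoint ab n : R * R := if n is n'.+1 then
  ((1 - del) * (ab n').1 + del * rho n, (1 - del) * (ab n').2 + del * rho n)
  else (A (fun=> 1) x0 / Lam, Lam * A (fun=> 1) x0).

Let del0 : 0 < del. Proof. by rewrite invr_gt0 exprn_gt0. Qed.

Let del1 : del <= 1.
Proof. by rewrite invf_le1 ?exprn_gt0// exprn_ege1. Qed.

(** The first conjunct keeps the lower endpoints away from zero, which is what later permits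
    division by [psi n.+1 x0]. *)
Let ab_bounds n : (ab 0).1 <= (ab n).1 /\
  forall x, (ab n).1 * psi n x <= psi n.+1 x <= (ab n).2 * psi n x.
Proof.
elim: n => [|n [an abn]].
  split=> // x; rewrite /psi/= !mulr1 Aharnack// andbT.
  by rewrite ler_pdivrMr// mulrC Aharnack.
(* The distances of [psi n.+1] to its two bounds are nonnegative, so [A_comparable] applies to each
   of them against [psi n]. *)
have Plo : forall x, 0 <= psi n.+1 x + (- (ab n).1) * psi n x.
  by move=> x; rewrite mulNr subr_ge0; case/andP: (abn x).
have Phi : forall x, 0 <= (ab n).2 * psi n x + (- 1) * psi n.+1 x.
  by move=> x; rewrite mulN1r subr_ge0; case/andP: (abn x).
have CPlo : C (fun x => psi n.+1 x + (- (ab n).1) * psi n x) by exact: Clin.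
have CPhi : C (fun x => (ab n).2 * psi n x + (- 1) * psi n.+1 x).
  by apply: Clin => //; exact: CZ.
have AP x : A (fun x => psi n.+1 x + (- (ab n).1) * psi n x) x =
    psi n.+2 x - (ab n).1 * psi n.+1 x by rewrite Alin// mulNr.
have AQ x : A (fun x => (ab n).2 * psi n x + (- 1) * psi n.+1 x) x =
    (ab n).2 * psi n.+1 x - psi n.+2 x.
  by rewrite Alin// ?AZ// ?mulN1r//; exact: CZ.
have pn0 : forall x, 0 <= psi n x by move=> x; exact: ltW.
have p0 : psi n.+1 x0 != 0 by rewrite gt_eqF.
split.
  apply: le_trans an _ => /=.
  have : (ab n).1 <= rho n.+1.
    by rewrite ler_pdivlMr// -subr_ge0 -AP Age0.
  by rewrite -subr_ge0 => h; have := mulr_ge0 (ltW del0) h; lra.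
move=> x; apply/andP; split.
  have := A_comparable CPlo (Cpsi n) Plo pn0 (psi_gt0 n.+1) x.
  rewrite !AP -[A (psi n) _]/(psi n.+1 _) -[A (psi n) _]/(psi n.+1 _).
  rewrite mulrBl mulfK// -/(rho n.+1) /=; lra.
have := A_comparable CPhi (Cpsi n) Phi pn0 (psi_gt0 n.+1) x.
rewrite !AQ -[A (psi n) _]/(psi n.+1 _) -[A (psi n) _]/(psi n.+1 _).
rewrite mulrBl mulfK// -/(rho n.+1) /=; lra.
Qed.

Let ab_gap n : (ab n).2 - (ab n).1 = ((ab 0).2 - (ab 0).1) * (1 - del) ^+ n.
Proof.
elim: n => [|n IHn]; first by rewrite expr0 mulr1.
rewrite exprS mulrCA -IHn /=; ring.
Qed.

Let phi n x := psi n x / psi n x0.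

Let K := Lam * ((ab 0).2 - (ab 0).1) / (ab 0).1.

Let a0_gt0 : 0 < (ab 0).1. Proof. by rewrite /= divr_gt0. Qed.

Let phi_step x n : `|phi n.+1 x - phi n x| <= K * (1 - del) ^+ n.
Proof.
have [an abn] := ab_bounds n.
have /andP[l1 u1] := abn x; have /andP[l2 u2] := abn x0.
have p0 := psi_gt0 n x0; have px := psi_gt0 n x.
have p1 := psi_gt0 n.+1 x0.
have -> : phi n.+1 x - phi n x =
    (psi n.+1 x * psi n x0 - psi n x * psi n.+1 x0) / (psi n x0 * psi n.+1 x0).
  by rewrite /phi; field; rewrite !gt_eqF.
rewrite normrM normfV (gtr0_norm (mulr_gt0 p0 p1)) ler_pdivrMr ?mulr_gt0//.
apply: (@le_trans _ _ (((ab n).2 - (ab n).1) * (psi n x * psi n x0))).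
  rewrite ler_norml; apply/andP; split.
    have h1 := ler_wpM2r (ltW p0) l1; have h2 := ler_wpM2l (ltW px) u2; lra.
  have h1 := ler_wpM2r (ltW p0) u1; have h2 := ler_wpM2l (ltW px) l2; lra.
(* [K] is split into its three sources: the interval gap, the Harnack bound
   [psi n x <= Lam * psi n x0], and [psi n x0 <= psi n.+1 x0 / (ab 0).1]. *)
have -> : K * (1 - del) ^+ n * (psi n x0 * psi n.+1 x0) =
    (((ab 0).2 - (ab 0).1) * (1 - del) ^+ n) *
    (Lam * psi n x0 * (psi n.+1 x0 / (ab 0).1)).
  by rewrite /K; field; rewrite gt_eqF.
rewrite -ab_gap ler_wpM2l//.
  by have := le_trans l2 u2; rewrite ler_pM2r// subr_ge0.
apply: ler_pM; [exact: ltW|exact: ltW|exact: psi_harnack|].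
rewrite ler_pdivlMr// mulrC; apply: le_trans l2.
by rewrite ler_pM2r.
Qed.

(** The normalised iterates [phi n] converge uniformly at a geometric rate, and the eigenvalue
    equation is the limit of [A (phi n) = rho n * phi n.+1]. *)
Lemma harnack_eigenfunction : exists mu psi, [/\ 0 < mu, C psi,
  (forall x, 0 < psi x) & forall x, A psi x = mu * psi x].
Proof.
have q0 : 0 <= 1 - del by rewrite subr_ge0.
have q1 : 1 - del < 1 by rewrite ltrBlDr ltrDl.
have /(@choice _ _) [p pP] : forall x, exists l, forall n,
    `|phi n x - l| <= K * (1 - del) ^+ n / (1 - (1 - del)).
  by move=> x; apply: geometric_steps_bound => // n; exact: phi_step.
have phi_cvg x : phi n x @[n --> \oo] --> p x.
  exact: geometric_bound_cvg (pP x).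
have Cphi n : C (phi n).
  rewrite (_ : phi n = fun x => (psi n x0)^-1 * psi n x); first exact: CZ.
  by apply/funext => x; rewrite mulrC.
have rate_cvg : (K * (1 - del) ^+ n / (1 - (1 - del))) @[n --> \oo] --> (0 : R).
  apply: (geometric_bound_cvg (K := K) q0 q1) => n.
  rewrite subr0 ger0_norm//; apply: le_trans (pP x0 n); exact: normr_ge0.
have Cp : C p.
  apply: (Climit Cphi) => e e0.
  have /cvgrPdist_le /(_ e e0) [n _ nP] := rate_cvg.
  exists n => x; apply: le_trans (pP x n) _.
  have := nP n (leqnn n); rewrite /= sub0r normrN; apply: le_trans.
  exact: ler_norm.
(* A uniform error [e] in the argument costs at most [e * A 1] in the value, by positivity and
   linearity. *)
have A_cvg x : A (phi n) x @[n --> \oo] --> A p x.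
  apply: (geometric_bound_cvg (K := K * A (fun=> 1) x) q0 q1) => n.
  have -> : K * A (fun=> 1) x * (1 - del) ^+ n / (1 - (1 - del)) =
      (K * (1 - del) ^+ n / (1 - (1 - del))) * A (fun=> 1) x by ring.
  rewrite -A_cst; set e := K * _ / _.
  have He y : `|phi n y - p y| <= e by exact: pP.
  have h1 : A p x + 1 * A (fun=> e) x >= A (phi n) x.
    rewrite -Alin//; apply: A_le => // [|y]; first exact: Clin.
    by have := He y; rewrite ler_norml mul1r => /andP[_ h]; lra.
  have h2 : A (phi n) x + 1 * A (fun=> e) x >= A p x.
    rewrite -Alin//; apply: A_le => // [|y]; first exact: Clin.
    by have := He y; rewrite ler_norml mul1r => /andP[h _]; lra.
  by rewrite ler_norml; apply/andP; split; lra.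
have Aphi n x : A (phi n) x = rho n * phi n.+1 x.
  rewrite (_ : phi n = fun x => (psi n x0)^-1 * psi n x).
    rewrite AZ// -[A (psi n) x]/(psi n.+1 x) /rho /phi.
    by field; rewrite !gt_eqF.
  by apply/funext => y; rewrite mulrC.
have phi1 n : phi n x0 = 1 by rewrite /phi divff ?gt_eqF.
have p1 x : Lam^-1 <= p x.
  have: cst Lam^-1 n @[n --> \oo] --> Lam^-1 by exact: cvg_cst.
  move=> /ler_cvg_to; apply; first exact: phi_cvg.
  apply: nearW => n; rewrite /phi ler_pdivlMr// mulrC ler_pdivrMr// mulrC.
  exact: psi_harnack.
(* Every [phi n] equals one at [x0], so [rho n = A (phi n) x0], whose limit is this eigenvalue. *)
exists (A p x0), p; split=> //.
- have := A_gt0 Cp _ p1 x0; rewrite invr_gt0 => /(_ Lam0).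
  by apply: lt_le_trans; rewrite divr_gt0// mulr_gt0// invr_gt0.
- by move=> x; apply: lt_le_trans (p1 x); rewrite invr_gt0.
move=> x; apply: (cvg_unique _ (A_cvg x)) => //.
rewrite (_ : (fun n => _) = (fun n => rho n * phi n.+1 x)); last exact/funext.
apply: cvgM; last by rewrite (cvg_shiftS (phi ^~ x)).
have := A_cvg x0.
rewrite (_ : (fun n => _) = rho)//.
by apply/funext => n; rewrite Aphi phi1 mulr1.
Qed.

End harnack_operator.

(** * Periodic and semiconcave functions *)

Section periodic_functions.
Context {R : realType} {n : nat}.
Implicit Types (x y z : 'rV[R]_n) (u : 'rV[R]_n -> R).

(** Plays the role of a fundamental domain: with [x = 0] it reduces periodic functions to the
    compact unit ball, and for general [x] it replaces [z] by an equivalent point near [x]. *)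
Lemma Zperiodic_translate x z :
  exists k : 'rV[int]_n, `|z + map_mx intr k - x| <= 1.
Proof.
exists (\row_i - Num.floor (z ord0 i - x ord0 i)).
apply: norm_row_le => // i; rewrite !mxE rmorphN/=.
have /andP[h1] := floor_itv (z ord0 i - x ord0 i); rewrite intrD => h2.
by rewrite ler_norml; apply/andP; split; lra.
Qed.

Lemma enorm_sqr x : enorm x ^+ 2 = \sum_i x ord0 i ^+ 2.
Proof. by rewrite sqr_sqrtr// sumr_ge0// => i _; exact: sqr_ge0. Qed.

Lemma enorm_sqr_ge0 x : 0 <= enorm x ^+ 2.
Proof. exact: sqr_ge0. Qed.

Lemma enorm_sqrZ a x : enorm (a *: x) ^+ 2 = a ^+ 2 * enorm x ^+ 2.
Proof.
rewrite !enorm_sqr mulr_sumr; apply: eq_bigr => i _.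
by rewrite mxE exprMn.
Qed.

Lemma enorm_sqr_le x : enorm x ^+ 2 <= n%:R * `|x| ^+ 2.
Proof.
rewrite enorm_sqr; apply: (@le_trans _ _ (\sum_(i < n) `|x| ^+ 2)).
  apply: ler_sum => i _; rewrite -(ger0_norm (sqr_ge0 _)) normrX.
  by rewrite lerXn2r ?nnegrE// coord_le_norm.
by rewrite sumr_const card_ord mulr_natl.
Qed.

Lemma compact_norm_le (c : R) : compact [set x : 'rV[R]_n | `|x| <= c].
Proof.
apply: bounded_closed_compact.
  exists c; split; first exact: num_real.
  by move=> M cM x /= xc; apply: le_trans xc _; exact: ltW.
rewrite (_ : [set x | _] = Num.norm @^-1` [set y : R | y <= c])//.
apply: closed_comp; last exact: closed_le.
by move=> x _; exact: norm_continuous.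
Qed.

Lemma Zperiodic_bounded u : continuous u -> Zperiodic u ->
  exists2 M, 0 < M & forall x, `|u x| <= M.
Proof.
move=> cu pu.
have : compact (u @` [set x | `|x| <= 1]).
  apply: continuous_compact; last exact: compact_norm_le.
  exact: continuous_subspaceT.
move=> /compact_bounded [M0 [_ /(_ (Num.max 1 (M0 + 1)))]].
rewrite lt_max ltrDl ltr01 orbT => /(_ isT) h.
exists (Num.max 1 (M0 + 1)); first by rewrite lt_max ltr01.
move=> x; have [k] := Zperiodic_translate 0 x; rewrite subr0 => k1.
by rewrite -(pu x k); apply: h; exists (x + map_mx intr k).
Qed.

Lemma Zperiodic_gt0_bounded u : continuous u -> Zperiodic u ->
  (forall x, 0 < u x) -> exists2 c, 0 < c & forall x, c <= u x.
Proof.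
move=> cu pu u0.
have [||M M0 uM] := @Zperiodic_bounded (fun x => (u x)^-1).
- by move=> x; apply: continuousV; [exact: lt0r_neq0|exact: cu].
- by move=> x k; rewrite pu.
exists M^-1; first by rewrite invr_gt0.
move=> x; rewrite -[leRHS]invrK lef_pV2 ?posrE ?invr_gt0//.
by apply: le_trans (uM x); exact: ler_norm.
Qed.

(** A tube argument gives the uniformity for [x] in the compact unit ball, and periodicity extends
    it to all [x]. *)
Lemma Zperiodic_unif_continuous u (w : 'rV[R]_n) (e : R) : continuous u -> Zperiodic u -> 0 < e ->
  \forall a \near w, forall x, `|u (x - a) - u (x - w)| <= e.
Proof.
move=> cu pu e0.
have /compact_near_coveringP cov := @compact_norm_le 1.
have : \forall a \near w, [set x : 'rV[R]_n | `|x| <= 1] `<=`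
    [set x | `|u (x - a) - u (x - w)| <= e].
  apply: (cov 'rV[R]_n (nbhs w) (fun a x => `|u (x - a) - u (x - w)| <= e)) => x _.
  have : (fun p : 'rV[R]_n * 'rV[R]_n => u (p.1 - p.2) - u (p.1 - w)) q
       @[q --> (x, w)] --> u (x - w) - u (x - w).
    apply: cvgB.
      apply: continuous_cvg; first exact: cu.
      by apply: cvgB; [exact: cvg_fst|exact: cvg_snd].
    apply: continuous_cvg; first exact: cu.
    by apply: cvgB; [exact: cvg_fst|exact: cvg_cst].
  move/cvgrPdist_le/(_ e e0); rewrite subrr.
  by apply: filterS => -[y a] /=; rewrite sub0r normrN.
apply: filterS => a ha x.
have [k] := Zperiodic_translate 0 x; rewrite subr0 => /ha/=.
by rewrite (addrAC x _ (- a)) (addrAC x _ (- w)) !pu.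
Qed.

(** Choose [y] so that [x + y] is a lattice translate of [z] with [|y| <= 1], and bound [w (x - y)]
    by the supremum [S]. Taking the supremum over [x] gives [S ^ 2 <= expR (s * n) * S * w z], and
    one factor [S] cancels. *)
Lemma harnack_of_logconvex (w : 'rV[R]_n -> R) s : 0 <= s -> Zperiodic w ->
  (forall x, 0 <= w x) -> (exists M, forall x, w x <= M) ->
  (forall x y, w x ^+ 2 <= expR (s * enorm y ^+ 2) * (w (x + y) * w (x - y))) ->
  forall x z, w x <= expR (s * n%:R) * w z.
Proof.
move=> s0 pw w0 [M wM] ww.
pose S := sup (range w).
have wS x : w x <= S by apply: ub_le_sup; [exists M => _ [y _ <-]|exists x].
have S0 : 0 <= S := le_trans (w0 0) (wS 0).
have h x z : w x ^+ 2 <= expR (s * n%:R) * S * w z.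
  have [k kz] := Zperiodic_translate x z.
  apply: le_trans (ww x (z + map_mx intr k - x)) _.
  rewrite -mulrA; apply: ler_pM; rewrite ?expR_ge0 ?mulr_ge0//.
    rewrite ler_expR ler_wpM2l// (le_trans (enorm_sqr_le _))//.
    by rewrite ler_piMr// expr_le1.
  by rewrite addrC subrK pw mulrC ler_pM.
move=> x z; have [S00|S1] := eqVneq S 0.
  by rewrite (le_trans (wS x))// S00 mulr_ge0 ?expR_ge0.
have Sp : 0 < S by rewrite lt_def S1.
apply: (le_trans (wS x)); apply: ge_sup; first by exists (w 0), 0.
move=> _ [y _ <-].
have : S <= Num.sqrt (expR (s * n%:R) * S * w z).
  apply: ge_sup; first by exists (w 0), 0.
  by move=> _ [t _ <-]; rewrite -[leLHS]ger0_norm// -sqrtr_sqr ler_wsqrtr.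
have r0 : 0 <= expR (s * n%:R) * S * w z by rewrite !mulr_ge0 ?expR_ge0.
rewrite -(@ler_pXn2r _ 2) ?nnegrE ?sqrtr_ge0// sqr_sqrtr// expr2.
rewrite [X in _ <= X * _]mulrC -[leRHS]mulrA ler_pM2l//.
by apply: le_trans; exact: wS.
Qed.

(** Along a line, successive increments grow by at most [t * |y| ^ 2] per step. A steep initial
    descent would therefore persist for about [1 / |y|] steps and break the lower bound [- D]. *)
Lemma semiconcave_bounded_lipschitz u s D : 0 <= s -> semiconcave s u ->
  (forall x, `|u x| <= D) ->
  exists2 K, 0 <= K & forall x y, `|u y - u x| <= K * `|y - x|.
Proof.
move=> s0 us uD.
have D0 : 0 <= D := le_trans (normr_ge0 _) (uD 0).
pose t := s * n%:R.
have t0 : 0 <= t by rewrite mulr_ge0.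
have us' x y : u (x + y) + u (x - y) - 2 * u x <= t * `|y| ^+ 2.
  apply: le_trans (us x y) _.
  by rewrite -mulrA ler_wpM2l// enorm_sqr_le.
have chain x y k :
    u (x + k.+1%:R *: y) - u (x + k%:R *: y) <=
      u (x + y) - u x + k%:R * (t * `|y| ^+ 2) /\
    u (x + k%:R *: y) <= u x + k%:R * (u (x + y) - u x)
      + k%:R ^+ 2 * (t * `|y| ^+ 2).
  have ty : 0 <= t * `|y| ^+ 2 by rewrite mulr_ge0 ?sqr_ge0.
  elim: k => [|k [IH1 IH2]].
    by rewrite scale1r scale0r addr0 !mul0r addr0 expr2 !mul0r !addr0; split.
  have kS : k.+1%:R = k%:R + 1 :> R by rewrite natr1.
  split.
    have := us' (x + k.+1%:R *: y) y.
    have -> : x + k.+1%:R *: y + y = x + k.+2%:R *: y.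
      by rewrite -addrA -[X in _ + (_ + X)]scale1r -scalerDl natr1.
    have -> : x + k.+1%:R *: y - y = x + k%:R *: y.
      by rewrite -addrA -[X in _ + (_ - X)]scale1r -scalerBl -natr1 addrK.
    move=> h; rewrite [X in _ <= _ + X * _]kS; lra.
  have k0 := ler0n R k; have := mulr_ge0 k0 ty.
  by rewrite [X in _ <= _ + X * _ + X ^+ 2 * _]kS; lra.
have lo x y : - ((2 * D + 2 * t) * `|y|) <= u (x + y) - u x.
  have [->|y0] := eqVneq y 0; first by rewrite addr0 subrr normr0 mulr0 oppr0.
  have yp : 0 < `|y| by rewrite normr_gt0.
  have [y1|y1] := leP 1 `|y|.
    have := uD (x + y); have := uD x; rewrite !ler_norml => /andP[a b] /andP[c d].
    have : D * 1 <= D * `|y| by rewrite ler_wpM2l.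
    have := mulr_ge0 t0 (ltW yp); lra.
  (* This number of steps makes the total distance [k * |y|] lie between 1 and 2. *)
  pose k := (Num.trunc `|y|^-1).+1.
  have k1 : `|y|^-1 <= k%:R by apply/ltW/truncnS_gt.
  have k2 : k%:R <= 2 * `|y|^-1.
    have : (Num.trunc `|y|^-1)%:R <= `|y|^-1 by rewrite truncn_le// invr_ge0.
    have : 1 <= `|y|^-1 by rewrite invf_ge1// ltW.
    rewrite /k -natr1; lra.
  have k0 : 0 < k%:R :> R by rewrite ltr0n.
  have [_ hk] := chain x y k.
  have := uD (x + k%:R *: y); have := uD x.
  rewrite !ler_norml => /andP[a b] /andP[c d].
  have h : - (2 * D) <= k%:R * (u (x + y) - u x) + k%:R ^+ 2 * (t * `|y| ^+ 2).
    lra.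
  rewrite -(ler_pM2l k0).
  have ky1 : 1 <= k%:R * `|y|.
    by rewrite -ler_pdivrMr// div1r.
  have ky2 : k%:R * `|y| <= 2.
    by rewrite -ler_pdivlMr.
  have h1 : 2 * D * 1 <= 2 * D * (k%:R * `|y|) by rewrite ler_wpM2l ?mulr_ge0.
  have h2 : t * (k%:R * `|y|) * (k%:R * `|y|) <= t * (k%:R * `|y|) * 2.
    by rewrite ler_wpM2l// mulr_ge0// (le_trans _ ky1).
  lra.
exists (2 * D + 2 * t); first by rewrite addr_ge0 ?mulr_ge0.
move=> x y; rewrite ler_norml; apply/andP; split.
  by have := lo x (y - x); rewrite [x + _]addrC subrK.
(* The upper bound is the lower one with the two points exchanged. *)
have := lo y (x - y); rewrite [y + _]addrC subrK distrC => h; lra.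
Qed.

Lemma lipschitz_bound_continuous u K :
  (forall x y, `|u y - u x| <= K * `|y - x|) -> continuous u.
Proof.
move=> uK x; apply/(@cvgrPdist_le _ _ _ (nbhs x)) => e e0.
have K1 : 0 < `|K| + 1 by rewrite ltr_wpDl.
near=> y.
rewrite (le_trans (uK y x))// (@le_trans _ _ ((`|K| + 1) * `|x - y|))//.
  by rewrite ler_wpM2r// (le_trans (ler_norm _))// lerDl.
rewrite mulrC -ler_pdivlMr//.
near: y; apply: (@cvgr_dist_le _ _ _ _ _ id x); first exact: cvg_id.
by rewrite divr_gt0.
Unshelve. all: by end_near. Qed.

End periodic_functions.

(** * Kernel operators *)

Section integral_cauchy_schwarz.
Context {R : realType} {n : nat}.
Implicit Types (f g : 'rV[R]_n -> R).

Lemma sqr_le_of_scaled_sums (I A B : R) : 0 <= I -> 0 <= A -> 0 <= B ->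
  (forall t, 0 < t -> 2 * I <= t * A + B / t) -> I ^+ 2 <= A * B.
Proof.
move=> I0 A0 B0 h; have [->|In0] := eqVneq I 0.
  by rewrite expr2 mul0r mulr_ge0.
have Ip : 0 < I by rewrite lt_def In0.
have [A00|An0] := eqVneq A 0.
  have B1 : 0 < B + 1 by rewrite ltr_wpDl.
  (* If [A = 0], the choice [t = (B + 1) / I] yields [2 * I <= I * (B / (B + 1)) <= I], a
     contradiction. Otherwise [t = I / A] is used below. *)
  have := h _ (divr_gt0 B1 Ip); rewrite A00 mulr0 add0r invf_div mulrCA.
  have : B / (B + 1) <= 1 by rewrite ler_pdivrMr// mul1r lerDl.
  move=> h1 h2; have : I * (B / (B + 1)) <= I * 1 by rewrite ler_wpM2l.
  move=> h3; exfalso; lra.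
have Ap : 0 < A by rewrite lt_def An0.
have := h _ (divr_gt0 Ip Ap); rewrite divfK// invf_div.
have -> : 2 * I = I + I by ring.
rewrite lerD2l mulrA ler_pdivlMr// => h1.
by rewrite expr2 mulrC [leRHS]mulrC.
Qed.

Lemma le_sqr_mul_sum (a b c t : R) : 0 <= b -> 0 <= c -> 0 < t ->
  a ^+ 2 <= b * c -> 2 * a <= t * b + c / t.
Proof.
move=> b0 c0 t0 abc.
have tb : 0 <= t * b + c / t by rewrite addr_ge0 ?mulr_ge0 ?invr_ge0// ltW.
have [a0|a0] := leP a 0; first by rewrite (le_trans _ tb)// mulr_ge0_le0.
rewrite -(@ler_pXn2r _ 2) ?nnegrE// ?mulr_ge0// ?(ltW a0)//.
have -> : (t * b + c / t) ^+ 2 = (t * b - c / t) ^+ 2 + 4 * (b * c).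
  by field; rewrite gt_eqF.
have -> : (2 * a) ^+ 2 = 4 * a ^+ 2 by ring.
by apply: ler_wpDl; [exact: sqr_ge0|rewrite ler_pM2l].
Qed.

(** The arithmetic-geometric inequality with weight [t] is applied pointwise and integrated, then
    [t] is optimised; no square root has to be integrated. *)
Lemma integral_rV_cauchy_schwarz f0 f1 f2 c : 0 <= c ->
  integrable_rV f0 -> integrable_rV f1 -> integrable_rV f2 ->
  (forall v, 0 <= f0 v) -> (forall v, 0 <= f1 v) -> (forall v, 0 <= f2 v) ->
  (forall v, f0 v ^+ 2 <= c * (f1 v * f2 v)) ->
  integral_rV f0 ^+ 2 <= c * (integral_rV f1 * integral_rV f2).
Proof.
move=> c0 i0 i1 i2 p0 p1 p2 h; rewrite mulrA.
apply: sqr_le_of_scaled_sums; rewrite ?mulr_ge0 ?integral_rV_ge0// => t t0.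
have -> : t * (c * integral_rV f1) + integral_rV f2 / t =
    integral_rV (fun v => t * c * f1 v + t^-1 * f2 v).
  rewrite integral_rVD ?integral_rVZ//; [|exact: integrable_rVZ..].
  by rewrite mulrA [_ / t]mulrC.
rewrite -integral_rVZ//; apply: le_integral_rV.
- exact: integrable_rVZ.
- by apply: integrable_rVD; exact: integrable_rVZ.
move=> v; rewrite -mulrA [t^-1 * _]mulrC; apply: le_sqr_mul_sum => //.
  by rewrite mulr_ge0.
by rewrite -mulrA.
Qed.

End integral_cauchy_schwarz.

Section kernel_operator.
Context {R : realType} {n : nat}.
Implicit Types (x y z v : 'rV[R]_n) (f : 'rV[R]_n -> R).
Variables (k : 'rV[R]_n -> 'rV[R]_n -> R) (tau M a alpha gamma : R).
Hypothesis tau0 : tau != 0.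
Hypothesis a0 : 0 < a.
Hypothesis alpha0 : 0 < alpha.
Hypothesis gamma0 : 0 < gamma.
Hypothesis kc : forall x, continuous (k x).
Hypothesis kp : forall v, Zperiodic (k ^~ v).
Hypothesis k0 : forall x v, 0 < k x v.
Hypothesis kM : forall x v, k x v <= M * expR (- (a * \sum_i `|v ord0 i|)).
(* The interpolated form of condition (3): the displacement [y] is split into
   [theta y], absorbed by the velocity, and [(1 - theta) y]. *)
Hypothesis ksc : forall theta x y v, 0 <= theta -> theta <= 1 ->
  k x v ^+ 2 <= expR ((alpha + gamma * theta ^+ 2) * enorm y ^+ 2) *
    (k (x + y) (v - (theta / tau) *: y) * k (x - y) (v + (theta / tau) *: y)).

(** One operator serves both equations: [tau = h] for the forward one and [tau = - h] for the
    backward one. *)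
Definition kernel_op f x := integral_rV (fun v => k x v * f (x + tau *: v)).

Let M0 : 0 < M.
Proof.
have := lt_le_trans (k0 0 0) (kM 0 0).
by rewrite pmulr_lgt0// expR_gt0.
Qed.

Lemma integrand_continuous f x : continuous f ->
  continuous (fun v => k x v * f (x + tau *: v)).
Proof.
move=> cf v; apply: continuousM; first exact: kc.
apply: (@continuous_comp _ _ _ (fun v => x + tau *: v) f); last exact: cf.
by apply: continuousD; [exact: cst_continuous|exact: scaler_continuous].
Qed.

Let env D v := (M * D) * expR (- (a * \sum_i `|v ord0 i|)).

Lemma integrand_bound f D x v : (forall x, `|f x| <= D) ->
  `|k x v * f (x + tau *: v)| <= env D v.
Proof.
move=> fD; rewrite normrM (gtr0_norm (k0 _ _)) /env mulrAC.
by apply: ler_pM => //; exact: ltW.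
Qed.

Lemma integrable_env D : integrable_rV (env D).
Proof. by apply: integrable_rVZ; exact: integrable_rV_expR_abs. Qed.

Lemma integrand_integrable f x : continuous f -> Zperiodic f ->
  integrable_rV (fun v => k x v * f (x + tau *: v)).
Proof.
move=> cf pf; have [D D0 fD] := Zperiodic_bounded cf pf.
apply: (integrable_rV_continuous _ (integrable_env D)).
  exact: integrand_continuous.
by move=> v; exact: integrand_bound.
Qed.

Lemma kernel_op_periodic f : Zperiodic f -> Zperiodic (kernel_op f).
Proof.
move=> pf x m; congr integral_rV; apply/funext => v.
by rewrite kp addrAC pf.
Qed.

Lemma kernel_opD f g c x : continuous f -> Zperiodic f ->
  continuous g -> Zperiodic g ->
  kernel_op (fun x => f x + c * g x) x = kernel_op f x + c * kernel_op g x.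
Proof.
move=> cf pf cg pg; rewrite -integral_rVZ; last exact: integrand_integrable.
rewrite -integral_rVD; first last.
- by apply: integrable_rVZ; exact: integrand_integrable.
- exact: integrand_integrable.
by congr integral_rV; apply/funext => v; ring.
Qed.

Lemma kernel_op_ge0 f : (forall x, 0 <= f x) -> forall x, 0 <= kernel_op f x.
Proof.
by move=> f0 x; apply: integral_rV_ge0 => v; rewrite mulr_ge0// ltW.
Qed.

Lemma kernel_op_bounded f : continuous f -> Zperiodic f ->
  exists B, forall x, kernel_op f x <= B.
Proof.
move=> cf pf; have [D D0 fD] := Zperiodic_bounded cf pf.
exists (integral_rV (env D)) => x; apply: le_integral_rV.
- exact: integrand_integrable.
- exact: integrable_env.
by move=> v; apply: le_trans (ler_norm _) (integrand_bound _ _ fD).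
Qed.

(** The reciprocal of the integrand is continuous, hence bounded on the unit ball, so the integrand
    has a positive lower bound there. *)
Lemma kernel_op_gt0 f : continuous f -> Zperiodic f -> (forall x, 0 < f x) ->
  forall x, 0 < kernel_op f x.
Proof.
move=> cf pf f0 x.
have G0 v : 0 < k x v * f (x + tau *: v) by rewrite mulr_gt0.
have cG : continuous (fun v => (k x v * f (x + tau *: v))^-1).
  move=> v; apply: (@continuousV R _ (fun v => k x v * f (x + tau *: v))).
    exact: lt0r_neq0.
  exact: integrand_continuous.
have : compact ((fun v => (k x v * f (x + tau *: v))^-1) @` [set v | `|v| <= 1]).
  apply: continuous_compact; last exact: compact_norm_le.
  apply: continuous_subspaceT; exact: cG.
move=> /compact_bounded [B0 [_ /(_ (Num.max 1 (B0 + 1)))]].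
rewrite lt_max ltrDl ltr01 orbT => /(_ isT) h.
set B := Num.max _ _ in h; have Bp : 0 < B by rewrite lt_max ltr01.
apply: (@lt_le_trans _ _ B^-1); first by rewrite invr_gt0.
apply: integral_rV_ge_box.
- exact: integrand_integrable.
- by move=> v; exact: ltW.
move=> v v1; rewrite -[leRHS]invrK lef_pV2 ?posrE ?invr_gt0//.
by rewrite (le_trans (ler_norm _))//; apply: h; exists v.
Qed.

(** Shifting the velocity by [- z] and [z] leaves the integrals at [x + y] and [x - y] unchanged;
    the pointwise hypothesis then integrates by Cauchy-Schwarz. *)
Lemma kernel_op_logconvex f x y z c : continuous f -> Zperiodic f ->
  (forall x, 0 <= f x) -> 0 <= c ->
  (forall v, (k x v * f (x + tau *: v)) ^+ 2 <= c *
    ((k (x + y) (v - z) * f (x + y + tau *: (v - z))) *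
     (k (x - y) (v + z) * f (x - y + tau *: (v + z))))) ->
  kernel_op f x ^+ 2 <= c * (kernel_op f (x + y) * kernel_op f (x - y)).
Proof.
move=> cf pf f0 c0 h.
have g0 x' v : 0 <= k x' v * f (x' + tau *: v) by rewrite mulr_ge0// ltW.
have sh x' z' : continuous (fun v => k x' (v + z') * f (x' + tau *: (v + z'))).
  move=> v; apply: (@continuous_comp _ _ _ (fun v => v + z')
    (fun v => k x' v * f (x' + tau *: v))); last exact: integrand_continuous.
  by apply: continuousD; [by move=> ?|exact: cst_continuous].
have ish x' z' : integrable_rV (fun v => k x' (v + z') * f (x' + tau *: (v + z'))).
  have [D D0 fD] := Zperiodic_bounded cf pf.
  (* By the triangle inequality the shift of the envelope costs only the factor
     [expR (a * \sum_i |z'_i|)]. *)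
  pose D' := M * D * expR (a * \sum_i `|z' ord0 i|).
  apply: (@integrable_rV_continuous _ _ _
    (fun v => D' * expR (- (a * \sum_i `|v ord0 i|)))) => //.
    by apply: integrable_rVZ; exact: integrable_rV_expR_abs.
  move=> v; apply: le_trans (integrand_bound _ _ fD) _.
  rewrite /env /D' -[leRHS]mulrA -expRD; apply: ler_wpM2l.
    by rewrite mulr_ge0// ltW.
  rewrite ler_expR -mulrN -mulrN -mulrDr ler_pM2l// -subr_ge0 opprK.
  rewrite addrAC -addrA -!sumrN -!big_split sumr_ge0//= => i _.
  rewrite mxE; have := ler_normB (v ord0 i + z' ord0 i) (z' ord0 i).
  by rewrite addrK; lra.
have -> : kernel_op f (x + y) =
    integral_rV (fun v => k (x + y) (v - z) * f (x + y + tau *: (v - z))).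
  rewrite (integral_rV_shift (- z) (f := fun v => k (x + y) v * f (x + y + tau *: v)))//.
  exact: integrand_continuous.
have -> : kernel_op f (x - y) =
    integral_rV (fun v => k (x - y) (v + z) * f (x - y + tau *: (v + z))).
  rewrite (integral_rV_shift z (f := fun v => k (x - y) v * f (x - y + tau *: v)))//.
  exact: integrand_continuous.
apply: integral_rV_cauchy_schwarz => //.
exact: integrand_integrable.
Qed.

Let s := alpha + gamma.

Let s0 : 0 <= s. Proof. by rewrite addr_ge0// ltW. Qed.

(** With [theta = 1] the velocity absorbs the whole displacement: both shifted arguments of [f]
    equal [x + tau *: v], so [f] enters only as a common square and the constant [s] does not depend
    on it. *)
Lemma kernel_op_log_semiconvex f x y : continuous f -> Zperiodic f -> (forall x, 0 <= f x) ->
  kernel_op f x ^+ 2 <=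
    expR (s * enorm y ^+ 2) * (kernel_op f (x + y) * kernel_op f (x - y)).
Proof.
move=> cf pf f0; apply: (kernel_op_logconvex (z := tau^-1 *: y)) => //.
move=> v.
have -> : x + y + tau *: (v - tau^-1 *: y) = x + tau *: v.
  by rewrite scalerBr scalerA divff// scale1r addrACA addrN addr0.
have -> : x - y + tau *: (v + tau^-1 *: y) = x + tau *: v.
  by rewrite scalerDr scalerA divff// scale1r addrACA addNr addr0.
have := @ksc 1 x y v ler01 (lexx _); rewrite expr1n mulr1 mul1r -/s.
move=> /(ler_wpM2r (sqr_ge0 (f (x + tau *: v)))); rewrite -exprMn.
by move=> /le_trans; apply; rewrite le_eqVlt; apply/orP; left; apply/eqP; ring.
Qed.

Lemma kernel_op_harnack f : continuous f -> Zperiodic f -> (forall x, 0 <= f x) ->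
  forall x y, kernel_op f x <= expR (s * n%:R) * kernel_op f y.
Proof.
move=> cf pf f0; apply: harnack_of_logconvex.
- exact: s0.
- exact: kernel_op_periodic.
- exact: kernel_op_ge0.
- exact: kernel_op_bounded.
- by move=> x y; exact: kernel_op_log_semiconvex.
Qed.

Lemma semiconcave_Nln (w : 'rV[R]_n -> R) sigma : (forall x, 0 < w x) ->
  (forall x y, w x ^+ 2 <= expR (sigma * enorm y ^+ 2) * (w (x + y) * w (x - y))) <->
  semiconcave sigma (fun x => - ln (w x)).
Proof.
move=> w0; split=> h x y; have := h x y.
- rewrite -ler_ln ?posrE ?exprn_gt0 ?mulr_gt0 ?expR_gt0//.
  rewrite lnM ?posrE ?mulr_gt0 ?expR_gt0// expRK lnM ?posrE// lnXn//; lra.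
- move=> {}h; rewrite -ler_ln ?posrE ?exprn_gt0 ?mulr_gt0 ?expR_gt0//.
  rewrite lnM ?posrE ?mulr_gt0 ?expR_gt0// expRK lnM ?posrE// lnXn//; lra.
Qed.

(** The function is semiconcave with modulus [s], and it is bounded because Harnack gives
    [kernel_op f] a positive lower bound. *)
Lemma ln_kernel_op_lipschitz f : continuous f -> Zperiodic f -> (forall x, 0 < f x) ->
  exists2 K, 0 <= K & forall x y,
    `|- ln (kernel_op f y) - - ln (kernel_op f x)| <= K * `|y - x|.
Proof.
move=> cf pf f0.
have fge0 x : 0 <= f x by exact: ltW.
have w0 := kernel_op_gt0 cf pf f0.
have [B wB] := kernel_op_bounded cf pf.
pose b := kernel_op f 0 / expR (s * n%:R).
have b0 : 0 < b by rewrite divr_gt0 ?expR_gt0.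
have wb x : b <= kernel_op f x.
  by rewrite ler_pdivrMr ?expR_gt0// mulrC kernel_op_harnack.
apply: (@semiconcave_bounded_lipschitz _ _ _ s (`|ln b| + `|ln B|)) => //.
- by apply/semiconcave_Nln => // x y; exact: kernel_op_log_semiconvex.
move=> x; rewrite normrN ler_norml.
have B0 : 0 < B := lt_le_trans (w0 0) (wB 0).
have h1 : ln b <= ln (kernel_op f x) by rewrite ler_ln ?posrE.
have h2 : ln (kernel_op f x) <= ln B by rewrite ler_ln ?posrE.
have := ler_norm (ln B); have := ler_norm (- ln b); rewrite normrN.
have := normr_ge0 (ln b); have := normr_ge0 (ln B).
by move=> p q r t; apply/andP; split; lra.
Qed.

Lemma kernel_op_continuous f : continuous f -> Zperiodic f ->
  (forall x, 0 < f x) -> continuous (kernel_op f).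
Proof.
move=> cf pf f0; have [K K0 h] := ln_kernel_op_lipschitz cf pf f0.
have cu := lipschitz_bound_continuous h.
have w0 := kernel_op_gt0 cf pf f0.
rewrite (_ : kernel_op f = fun x => expR (- - ln (kernel_op f x))).
  move=> x; apply: (@continuous_comp _ _ _ (fun x => - ln (kernel_op f x))
    (fun t => expR (- t))); first exact: cu.
  by apply: continuous_comp; [exact: opp_continuous|exact: continuous_expR].
by apply/funext => x; rewrite opprK lnK ?posrE.
Qed.

Lemma uniform_limit_continuous (f_ : nat -> 'rV[R]_n -> R) f :
  (forall m, continuous (f_ m)) ->
  (forall e, 0 < e -> exists m, forall x, `|f_ m x - f x| <= e) -> continuous f.
Proof.
move=> cf h x; apply/(@cvgrPdist_le _ _ _ (nbhs x)) => e e0.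
have [|m hm] := h (e / 3); first by rewrite divr_gt0.
have /(@cvgrPdist_le _ _ _ (nbhs x)) /(_ (e / 3)) := cf m x.
rewrite divr_gt0// => /(_ isT); apply: filterS => y.
have := hm x; have := hm y; rewrite !ler_norml.
by move=> /andP[? ?] /andP[? ?] /andP[? ?]; apply/andP; split; lra.
Qed.

(** One application of the operator trades the modulus: the arguments of [psi] are now displaced
    only by [(1 - theta) *: y], while the kernel pays [alpha + gamma * theta ^ 2]. The eigenvalue
    cancels on both sides. *)
Lemma semiconcave_improve psi mu sigma theta : 0 < mu ->
  continuous psi -> Zperiodic psi -> (forall x, 0 < psi x) ->
  (forall x, kernel_op psi x = mu * psi x) -> 0 <= theta -> theta <= 1 ->
  semiconcave sigma (fun x => - ln (psi x)) ->
  semiconcave (alpha + gamma * theta ^+ 2 + sigma * (1 - theta) ^+ 2)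
    (fun x => - ln (psi x)).
Proof.
move=> mu0 cpsi ppsi psi0 eig t0 t1 /(semiconcave_Nln _ psi0) hs.
apply/semiconcave_Nln => // x y.
set c := expR _.
have : kernel_op psi x ^+ 2 <= c * (kernel_op psi (x + y) * kernel_op psi (x - y)).
  apply: (kernel_op_logconvex (z := (theta / tau) *: y)) => //.
  - by move=> {}x; exact: ltW.
  - exact: expR_ge0.
  move=> v.
  have E1 : x + y + tau *: (v - (theta / tau) *: y) =
      (x + tau *: v) + (1 - theta) *: y.
    rewrite scalerBr scalerA [tau * _]mulrC divfK// scalerBl scale1r.
    by rewrite addrACA.
  have E2 : x - y + tau *: (v + (theta / tau) *: y) =
      (x + tau *: v) - (1 - theta) *: y.
    rewrite scalerDr scalerA [tau * _]mulrC divfK// scalerBl scale1r opprB.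
    by rewrite addrACA [- y + _]addrC.
  rewrite E1 E2 exprMn.
  have h1 := @ksc theta x y v t0 t1.
  have h2 := hs (x + tau *: v) ((1 - theta) *: y).
  have := ler_pM (sqr_ge0 _) (sqr_ge0 _) h1 h2.
  have -> : c = expR ((alpha + gamma * theta ^+ 2) * enorm y ^+ 2) *
      expR (sigma * enorm ((1 - theta) *: y) ^+ 2).
    by rewrite enorm_sqrZ -expRD /c; congr expR; ring.
  move=> /le_trans; apply; rewrite le_eqVlt; apply/orP; left; apply/eqP; ring.
rewrite !eig exprMn.
have -> : c * (mu * psi (x + y) * (mu * psi (x - y))) =
  mu ^+ 2 * (c * (psi (x + y) * psi (x - y))) by ring.
by rewrite ler_pM2l// exprn_gt0.
Qed.

(** Ensures that a best modulus exists, to which the improvement can be applied. *)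
Lemma semiconcave_inf (u : 'rV[R]_n -> R) (E : set R) : E !=set0 ->
  (forall r, E r -> 0 <= r) -> (forall r, E r -> semiconcave r u) ->
  semiconcave (inf E) u.
Proof.
move=> E0 Ege Es x y.
have [e0|e0] := eqVneq (enorm y ^+ 2) 0.
  by case: E0 => r /Es /(_ x y); rewrite e0 !mulr0.
have ep : 0 < enorm y ^+ 2 by rewrite lt_def e0 enorm_sqr_ge0.
rewrite -ler_pdivrMr//; apply: lb_le_inf => // r Er.
by rewrite ler_pdivrMr//; exact: Es.
Qed.

Lemma kernel_op_eigenfunction : exists mu psi, [/\ 0 < mu,
  continuous psi /\ Zperiodic psi, forall x, 0 < psi x,
  forall x, kernel_op psi x = mu * psi x &
  (exists2 K, 0 <= K & forall x y, `|- ln (psi y) - - ln (psi x)| <= K * `|y - x|)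
  /\ exists sigma, [/\ 0 <= sigma, semiconcave sigma (fun x => - ln (psi x)) &
     sigma ^+ 2 <= alpha * (gamma + sigma)]].
Proof.
pose C (f : 'rV[R]_n -> R) := continuous f /\ Zperiodic f.
have C1 : C (fun=> 1) by split=> //; exact: cst_continuous.
have Clin f g c : C f -> C g -> C (fun x => f x + c * g x).
  move=> [cf pf] [cg pg]; split=> [x|x m]; last by rewrite pf pg.
  apply: (@continuousD R R 'rV[R]_n f (fun x => c * g x)); first exact: cf.
  by apply: (@continuousM R 'rV[R]_n (fun=> c) g); [exact: cst_continuous|exact: cg].
have Clim (f_ : nat -> 'rV[R]_n -> R) f : (forall m, C (f_ m)) ->
  (forall e, 0 < e -> exists m, forall x, `|f_ m x - f x| <= e) -> C f.
  move=> Cf h; split.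
    by apply: (uniform_limit_continuous _ h) => m; exact: (Cf m).1.
  move=> x m; apply/eqP; rewrite -subr_eq0 -normr_le0.
  apply/ler_addgt0Pl => e e0; rewrite addr0.
  have [|j hj] := h (e / 2); first by rewrite divr_gt0.
  have := hj x; have := hj (x + map_mx intr m); rewrite (Cf j).2 !ler_norml.
  by move=> /andP[? ?] /andP[? ?]; apply/andP; split; lra.

have [mu [psi [mu0 [cpsi ppsi] psi0 eig]]] :=
  @harnack_eigenfunction R _ 0 C kernel_op (expR (s * n%:R)) C1 Clin Clim
  (fun f g c Cf Cg x => @kernel_opD f g c x Cf.1 Cf.2 Cg.1 Cg.2)
  (fun f _ ge0 => @kernel_op_ge0 f ge0)
  (fun f Cf ge0 => kernel_op_harnack Cf.1 Cf.2 ge0)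
  (fun f Cf gt0 => conj (kernel_op_continuous Cf.1 Cf.2 gt0)
    (kernel_op_periodic Cf.2))
  (kernel_op_gt0 C1.1 C1.2 (fun=> ltr01)).
exists mu, psi; split=> //.
(* The two logarithms differ by a constant, so the Lipschitz and semiconcavity bounds for
   [kernel_op psi] pass to [psi]. *)
have lnE x : - ln (kernel_op psi x) = - ln (psi x) - ln mu.
  by rewrite eig lnM ?posrE// opprD addrC.
split.
  have [K K0 h] := ln_kernel_op_lipschitz cpsi ppsi psi0.
  exists K => // x y; have := h x y; rewrite !lnE.
  by rewrite [in - (_ - ln mu)]opprB addrA subrK.
pose E := [set r | 0 <= r /\ semiconcave r (fun x => - ln (psi x))].
have Ene : E !=set0.
  exists s; split; first exact: s0.
  have : semiconcave s (fun x => - ln (kernel_op psi x)).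
    apply/semiconcave_Nln; first exact: kernel_op_gt0.
    by move=> x y; apply: kernel_op_log_semiconvex => // z; exact: ltW.
  by move=> h x y; have := h x y; rewrite !lnE; lra.
have Einf : semiconcave (inf E) (fun x => - ln (psi x)).
  by apply: semiconcave_inf => // r [].
have inf0 : 0 <= inf E by apply: lb_le_inf => // r [].
exists (inf E); split=> //.
set r := inf E in inf0 Einf *.
have gr : 0 < gamma + r by rewrite ltr_wpDr.
(* This [theta] minimises [gamma * theta ^+ 2 + r * (1 - theta) ^+ 2]. *)
pose theta := r / (gamma + r).
have t0 : 0 <= theta by rewrite divr_ge0// ltW.
have t1 : theta <= 1 by rewrite ler_pdivrMr// mul1r lerDr ltW.
have := semiconcave_improve mu0 cpsi ppsi psi0 eig t0 t1 Einf.
set r' := (X in semiconcave X) => hr'.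
have r'0 : 0 <= r'.
  have h1 : 0 <= gamma * theta ^+ 2 by rewrite mulr_ge0 ?sqr_ge0// ltW.
  have h2 : 0 <= r * (1 - theta) ^+ 2 by rewrite mulr_ge0 ?sqr_ge0.
  by rewrite addr_ge0// addr_ge0// ltW.
(* The improved modulus cannot beat the best one; multiplying by [gamma + r] gives the quadratic
   inequality. *)
have : r <= r' by apply: ge_inf => //; exists 0 => z [].
have -> : r' = alpha + gamma * r / (gamma + r).
  by rewrite /r' /theta; field; rewrite gt_eqF.
rewrite -(subr_ge0 r) => h; have := mulr_ge0 (ltW gr) h.
have -> : (gamma + r) * (alpha + gamma * r / (gamma + r) - r) =
  alpha * (gamma + r) - r ^+ 2 by field; rewrite gt_eqF.
by rewrite subr_ge0.
Qed.

End kernel_operator.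

(** * Adjoint operators on the torus *)

Section grid_mean.
Context {R : realType} {n : nat}.
Implicit Types (u : 'rV[R]_n -> R).

(** Indices in ['I_m.+1] add modulo [m.+1], so the grid is a finite subgroup of the torus. *)
Definition grid_point m (j : 'rV['I_m.+1]_n) : 'rV[R]_n :=
  \row_i ((j ord0 i : nat)%:R / m.+1%:R).

Definition grid_mean u m : R :=
  #|{: 'rV['I_m.+1]_n}|%:R^-1 * \sum_(j : 'rV['I_m.+1]_n) u (grid_point j).

Lemma grid_card_gt0 m : 0 < #|{: 'rV['I_m.+1]_n}|%:R :> R.
Proof. by rewrite ltr0n; apply/card_gt0P; exists 0. Qed.

Lemma grid_point_add m (j b : 'rV['I_m.+1]_n) :
  exists q : 'rV[int]_n, grid_point (j + b) = grid_point j + grid_point b + map_mx intr q.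
Proof.
exists (\row_i - ((j ord0 i + b ord0 i) %/ m.+1)%N%:Z).
apply/rowP => i; rewrite !mxE/=.
have m0 : m.+1%:R != 0 :> R by rewrite pnatr_eq0.
apply: (mulIf m0); rewrite !mulrDl !divfK// -natrD.
rewrite {2}(divn_eq (j ord0 i + b ord0 i) m.+1) natrD natrM.
by rewrite rmorphN/= mulNr addrAC subrr add0r.
Qed.

(** Translation by a grid point permutes the grid up to lattice vectors. *)
Lemma grid_mean_translate u m (b : 'rV['I_m.+1]_n) : Zperiodic u ->
  grid_mean (fun x => u (x - grid_point b)) m = grid_mean u m.
Proof.
move=> pu; congr (_ * _); rewrite (reindex_inj (addIr b)) /=.
apply: eq_bigr => j _; have [q ->] := grid_point_add j b.
by rewrite addrAC addrK pu.
Qed.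

(** Round [m.+1 * w] down; division by [m.+1] splits the result into a remainder, the grid index,
    and a quotient, the lattice vector. *)
Lemma grid_point_dense m (w : 'rV[R]_n) : exists (b : 'rV['I_m.+1]_n) (q : 'rV[int]_n),
  `|w - (grid_point b + map_mx intr q)| <= m.+1%:R^-1.
Proof.
pose F i := Num.floor (m.+1%:R * w ord0 i).
have Fm i : (`|(F i %% m.+1)%Z|%N < m.+1)%N.
  by rewrite -ltz_nat gez0_abs ?modz_ge0// ltz_pmod.
exists (\row_i Ordinal (Fm i)), (\row_i (F i %/ m.+1)%Z).
apply: norm_row_le => [|i]; first by rewrite invr_ge0.
rewrite !mxE/=.
have m0 : 0 < m.+1%:R :> R by rewrite ltr0n.
have E : (`|(F i %% m.+1)%Z|%N)%:R / m.+1%:R + ((F i %/ m.+1)%Z)%:~R =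
    (F i)%:~R / m.+1%:R :> R.
  rewrite {3}(divz_eq (F i) m.+1) rmorphD rmorphM/= mulrDl mulfK ?gt_eqF//.
  by rewrite addrC -[_%:R]/((Posz _)%:~R) gez0_abs ?modz_ge0.
rewrite E -[leRHS]div1r ler_pdivlMr// -[X in _ * X](gtr0_norm m0) -normrM.
rewrite mulrBl divfK ?gt_eqF// [w _ _ * _]mulrC.
have /andP[h1] := @floor_itv R (m.+1%:R * w ord0 i).
rewrite intrD -/(F i) => h2.
by rewrite ler_norml; apply/andP; split; lra.
Qed.

Lemma le_grid_mean u1 u2 m : (forall x, u1 x <= u2 x) ->
  grid_mean u1 m <= grid_mean u2 m.
Proof.
move=> h; rewrite /grid_mean ler_pM2l ?invr_gt0 ?grid_card_gt0//.
exact: ler_sum.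
Qed.

Lemma grid_mean_cst c m : grid_mean (fun=> c) m = c.
Proof.
rewrite /grid_mean sumr_const -[c *+ _]mulr_natr mulrCA mulVf ?mulr1//.
by rewrite gt_eqF// grid_card_gt0.
Qed.

Lemma grid_meanB u1 u2 m :
  grid_mean u1 m - grid_mean u2 m = grid_mean (fun x => u1 x - u2 x) m.
Proof. by rewrite /grid_mean -mulrBr sumrB. Qed.

Lemma grid_meanZ c u m : grid_mean (fun x => c * u x) m = c * grid_mean u m.
Proof. by rewrite /grid_mean -mulr_sumr mulrCA. Qed.

Lemma grid_mean_norm u m e : (forall x, `|u x| <= e) -> `|grid_mean u m| <= e.
Proof.
move=> h; rewrite ler_norml -(grid_mean_cst (- e) m) -{2}(grid_mean_cst e m).
by apply/andP; split; apply: le_grid_mean => x; have := h x;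
  rewrite ler_norml => /andP[].
Qed.

(** Replace [w] by a nearby grid point, for which the mean is exactly invariant; uniform continuity
    controls the replacement. *)
Lemma grid_mean_translate_cvg0 u (w : 'rV[R]_n) : continuous u -> Zperiodic u ->
  grid_mean u m - grid_mean (fun x => u (x - w)) m @[m --> \oo] --> (0 : R).
Proof.
move=> cu pu; apply/cvgrPdist_le => e e0.
have /nbhs_ballP[d /= d0 hd] := Zperiodic_unif_continuous w cu pu e0.
near=> m.
have [b [q bq]] := grid_point_dense m w.
rewrite sub0r normrN -(grid_mean_translate b pu) grid_meanB.
apply: grid_mean_norm => x.
have -> : u (x - grid_point b) = u (x - (grid_point b + map_mx intr q)).
  by rewrite opprD addrA -[LHS](pu _ (- q)) map_mxN.
apply: hd; rewrite -ball_normE/=; apply: le_lt_trans bq _.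
near: m; exact: (near_infty_natSinv_lt (PosNum d0)).
Unshelve. all: by end_near. Qed.

Lemma continuous_grid_mean (F : 'rV[R]_n -> 'rV[R]_n -> R) m :
  (forall x, continuous (F x)) -> continuous (fun v => grid_mean (F ^~ v) m).
Proof.
move=> cF v; apply: (@continuousM R 'rV[R]_n (fun=> _)).
  exact: cst_continuous.
by apply: (@continuous_big _ _ _ _ _ _ _ _) => //; exact: add_continuous.
Qed.

Lemma integral_grid_mean (F : 'rV[R]_n -> 'rV[R]_n -> R) m :
  (forall x, integrable_rV (F x)) ->
  integrable_rV (fun v => grid_mean (F ^~ v) m) /\
  integral_rV (fun v => grid_mean (F ^~ v) m) =
    grid_mean (fun x => integral_rV (F x)) m.
Proof.
move=> iF; split.
  by apply: integrable_rVZ; apply: integrable_rV_sum => j; exact: iF.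
rewrite integral_rVZ; last by apply: integrable_rV_sum => j; exact: iF.
by rewrite integral_rV_sum.
Qed.

End grid_mean.

Section adjoint_eigenvalues.
Context {R : realType} {n : nat}.
Variables (k : 'rV[R]_n -> 'rV[R]_n -> R) (tau M a : R).
Local Notation k' := (fun x v : 'rV[R]_n => k (x - tau *: v) v).
Hypothesis a0 : 0 < a.
Hypothesis kcx : forall v, continuous (k ^~ v).
Hypothesis kc : forall x, continuous (k x).
Hypothesis kc' : forall x, continuous (k' x).
Hypothesis kp : forall v, Zperiodic (k ^~ v).
Hypothesis k0 : forall x v, 0 < k x v.
Hypothesis kM : forall x v, k x v <= M * expR (- (a * \sum_i `|v ord0 i|)).

(* The two operators are adjoint for the mean over the torus, which is
   approximated here by means over finer and finer grids. *)
Lemma adjoint_eigenvalues (f g : 'rV[R]_n -> R) mu nu :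
  continuous f -> Zperiodic f -> (forall x, 0 < f x) ->
  continuous g -> Zperiodic g -> (forall x, 0 < g x) ->
  (forall x, kernel_op k tau f x = mu * f x) ->
  (forall x, kernel_op k' (- tau) g x = nu * g x) -> mu = nu.
Proof.
move=> cf pf f0 cg pg g0 fmu gnu.
have [Df Df0 fD] := Zperiodic_bounded cf pf.
have [Dg Dg0 gD] := Zperiodic_bounded cg pg.
pose F x v := g x * (k x v * f (x + tau *: v)).
pose G x v := f x * (k' x v * g (x + (- tau) *: v)).
have GF x v : G x v = F (x - tau *: v) v.
  (* For each velocity, [G] is [F] translated by [tau *: v]; this is the adjointness. *)
  by rewrite /G /F scaleNr subrK; ring.
have iF x : integrable_rV (F x).
  by apply: integrable_rVZ; exact: (integrand_integrable tau a0 kc k0 kM x cf pf).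
have iG x : integrable_rV (G x).
  apply: integrable_rVZ.
  exact: (integrand_integrable (- tau) a0 kc' (fun x v => k0 _ v)
    (fun x v => kM _ v) x cg pg).
have ccf x : continuous (F x).
  move=> v; apply: (@continuousM R 'rV[R]_n (fun=> g x)).
    exact: cst_continuous.
  exact: (@integrand_continuous _ _ k tau kc f x cf v).
have ccg x : continuous (G x).
  move=> v; apply: (@continuousM R 'rV[R]_n (fun=> f x)).
    exact: cst_continuous.
  exact: (@integrand_continuous _ _ k' (- tau) kc' g x cg v).
pose D m v := grid_mean (F ^~ v) m - grid_mean (G ^~ v) m.
have ID m : integral_rV (D m) = (mu - nu) * grid_mean (fun x => f x * g x) m.
  have [iFm EF] := integral_grid_mean m iF.
  have [iGm EG] := integral_grid_mean m iG.
  have -> : integral_rV (D m) = integral_rV (fun v => grid_mean (F ^~ v) m) -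
      integral_rV (fun v => grid_mean (G ^~ v) m).
    have := integral_rVD iFm (integrable_rVZ (-1) iGm).
    rewrite (integral_rVZ _ iGm) mulN1r => <-; congr integral_rV.
    by apply/funext => v; rewrite mulN1r.
  rewrite EF EG mulrBl -!grid_meanZ.
  congr (_ - _); congr (grid_mean _ _); apply/funext => x.
    rewrite /F integral_rVZ; last exact: (integrand_integrable tau a0 kc k0 kM x cf pf).
    by rewrite -/(kernel_op k tau f x) fmu; ring.
  rewrite /G integral_rVZ; last first.
    exact: (integrand_integrable (- tau) a0 kc' (fun x v => k0 _ v)
    (fun x v => kM _ v) x cg pg).
  by rewrite -/(kernel_op k' (- tau) g x) gnu; ring.
(* For fixed [v] the two grid means agree in the limit by translation invariance; dominated
   convergence carries this to the integral over [v]. *)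
have D0 : integral_rV (D m) @[m --> \oo] --> 0.
  apply: (@integral_rV_dominated_cvg0 _ _ D
    (fun v => (2 * (Dg * (M * Df))) * expR (- (a * \sum_i `|v ord0 i|)))).
  - move=> m v; apply: (@continuousB R R 'rV[R]_n).
      exact: continuous_grid_mean.
    exact: continuous_grid_mean.
  - by apply: integrable_rVZ; exact: integrable_rV_expR_abs.
  - move=> m v; apply: le_trans (ler_normB _ _) _.
    have hF x : `|F x v| <= Dg * (M * Df) * expR (- (a * \sum_i `|v ord0 i|)).
      rewrite normrM -mulrA; apply: ler_pM => //.
      exact: (integrand_bound tau k0 kM x v fD).
    have h1 := grid_mean_norm m hF.
    have hG x : `|G x v| <= Dg * (M * Df) * expR (- (a * \sum_i `|v ord0 i|)).
      by rewrite GF.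
    have h2 := grid_mean_norm m hG; lra.
  move=> v; rewrite /D.
  have := @grid_mean_translate_cvg0 R n (F ^~ v) (tau *: v).
  have -> : (fun x => F (x - tau *: v) v) = G ^~ v.
    by apply/funext => x; rewrite GF.
  apply.
    move=> x; apply: (@continuousM R 'rV[R]_n g
      (fun x => k x v * f (x + tau *: v))); first exact: cg.
    apply: (@continuousM R 'rV[R]_n (k ^~ v)); first exact: kcx.
    apply: (@continuous_comp 'rV[R]_n 'rV[R]_n R (fun x => x + tau *: v) f).
      apply: (@continuousD R 'rV[R]_n 'rV[R]_n id); first by move=> ?.
      exact: cst_continuous.
    exact: cf.
  by move=> x q; rewrite /F pg kp addrAC pf.
(* The means of [f * g] stay above [c], so [(mu - nu)] times them can tend to zero only if
   [mu = nu]. *)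
have [c c0 hc] : exists2 c, 0 < c & forall x, c <= f x * g x.
  have [c1 c10 h1] := Zperiodic_gt0_bounded cf pf f0.
  have [c2 c20 h2] := Zperiodic_gt0_bounded cg pg g0.
  exists (c1 * c2); first exact: mulr_gt0.
  by move=> x; apply: ler_pM => //; exact: ltW.
apply/eqP; rewrite -subr_eq0 -normr_le0 -(pmulr_lle0 _ c0).
have nD : `|integral_rV (D m)| @[m --> \oo] --> (0 : R).
  by rewrite -(@normr0 _ R); exact: cvg_norm.
apply: (ler_cvg_to (cvg_cst (`|mu - nu| * c)) nD).
apply: nearW => m; rewrite ID normrM ler_wpM2l//.
apply: le_trans (ler_norm _).
by rewrite -(@grid_mean_cst R n c m); exact: le_grid_mean.
Qed.

End adjoint_eigenvalues.

(** * Gibbs kernels of a Lagrangian *)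

Section lagrangian.
Context {R : realType} {n : nat}.
Implicit Types (x y v : 'rV[R]_n).
Variable L : 'rV[R]_n -> 'rV[R]_n -> R.
Hypothesis L_continuous : continuous (fun p : 'rV[R]_n * 'rV[R]_n => L p.1 p.2).
Hypothesis L_periodic : forall v, Zperiodic (L ^~ v).

Lemma coord_le_enorm v i : `|v ord0 i| <= enorm v.
Proof.
rewrite -sqrtr_sqr ler_wsqrtr// (bigD1 i)//= lerDl sumr_ge0// => j _.
exact: sqr_ge0.
Qed.

Lemma norm_le_enorm v : `|v| <= enorm v.
Proof. by apply: norm_row_le => [|i]; [exact: sqrtr_ge0|exact: coord_le_enorm]. Qed.

Lemma superlinear_lower_bound : superlinear L ->
  exists B, forall x v, \sum_i `|v ord0 i| - B <= L x v.
Proof.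
(* Slope [n] suffices because [\sum_i |v_i| <= n * enorm v]; velocities of norm at most [rho] are
   treated by compactness and periodicity. *)
move=> /(_ n%:R) [r hr].
pose rho := Num.max r 0.
have rho0 : 0 <= rho by rewrite le_max lexx orbT.
have : compact ((fun p : 'rV[R]_n * 'rV[R]_n => L p.1 p.2) @`
    ([set x | `|x| <= 1] `*` [set v | `|v| <= rho])).
  apply: continuous_compact; first exact: continuous_subspaceT.
  by apply: compact_setX; exact: compact_norm_le.
move=> /compact_bounded [B0 [_ /(_ (B0 + 1))]]; rewrite ltrDl ltr01 => /(_ isT) hB.
exists (Num.max 0 (n%:R * rho + (B0 + 1))) => x v.
have sum_le : \sum_i `|v ord0 i| <= n%:R * enorm v.
  rewrite -[X in _ <= X%:R * _]card_ord mulr_natl -sumr_const.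
  by apply: ler_sum => i _; exact: coord_le_enorm.
have [vr|vr] := leP (enorm v) rho.
  have [m] := Zperiodic_translate 0 x; rewrite subr0 => xm.
  rewrite -(L_periodic v x m).
  have := hB (L (x + map_mx intr m) v); rewrite /= => /(_ _)/wrap[].
    exists (x + map_mx intr m, v) => //; split=> //=.
    exact: le_trans (norm_le_enorm v) vr.
  rewrite ler_norml => /andP[h _].
  have : n%:R * enorm v <= n%:R * rho by rewrite ler_wpM2l.
  have : n%:R * rho + (B0 + 1) <= Num.max 0 (n%:R * rho + (B0 + 1)).
    by rewrite le_max lexx orbT.
  lra.
have v0 : 0 < enorm v by apply: le_lt_trans vr.
have := hr x v; rewrite (le_lt_trans _ vr) ?le_max ?lexx// => /(_ isT).
rewrite ler_pdivlMr// => h.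
have : 0 <= Num.max 0 (n%:R * rho + (B0 + 1)) by rewrite le_max lexx.
by move=> ?; lra.
Qed.

Definition gibbs_kernel eps x v := expR (- (L x v / eps)).

Lemma gibbs_kernel_continuous eps (p q : 'rV[R]_n -> 'rV[R]_n) :
  continuous p -> continuous q -> continuous (fun v => gibbs_kernel eps (p v) (q v)).
Proof.
move=> cp cq v.
have cL : {for v, continuous (fun v => L (p v) (q v))}.
  apply: (@continuous_comp _ _ _ (fun v => (p v, q v))
    (fun p : 'rV[R]_n * 'rV[R]_n => L p.1 p.2)); last exact: L_continuous.
  exact: (cvg_pair (cp v) (cq v)).
have ce : continuous (fun t : R => expR (- (t / eps))).
  move=> t; apply: continuous_comp; last exact: continuous_expR.
  by apply: cvgN; apply: cvgMl; exact: cvg_id.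
exact: (@continuous_comp _ _ _ (fun v => L (p v) (q v))
  (fun t : R => expR (- (t / eps))) v cL (ce _)).
Qed.

Lemma gibbs_kernel_le eps B x v : 0 < eps ->
  (forall x v, \sum_i `|v ord0 i| - B <= L x v) ->
  gibbs_kernel eps x v <= expR (B / eps) * expR (- (eps^-1 * \sum_i `|v ord0 i|)).
Proof.
move=> e0 hB; rewrite -expRD ler_expR.
have : eps^-1 * (\sum_i `|v ord0 i| - B) <= eps^-1 * L x v.
  by rewrite ler_pM2l ?invr_gt0.
by lra.
Qed.

Lemma gibbs_kernel_logconvex eps x y v z c : 0 < eps ->
  L (x + y) (v - z) + L (x - y) (v + z) - 2 * L x v <= eps * c ->
  gibbs_kernel eps x v ^+ 2 <=
    expR c * (gibbs_kernel eps (x + y) (v - z) * gibbs_kernel eps (x - y) (v + z)).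
Proof.
move=> e0 h; rewrite expr2 -!expRD ler_expR -(ler_pM2l e0).
have -> : eps * (- (L x v / eps) - L x v / eps) = - (2 * L x v).
  by field; rewrite gt_eqF.
have -> : eps * (c + (- (L (x + y) (v - z) / eps) - L (x - y) (v + z) / eps)) =
    eps * c - (L (x + y) (v - z) + L (x - y) (v + z)).
  by field; rewrite gt_eqF.
by lra.
Qed.

Variables (C Gamma eps h : R).
Hypothesis eps0 : 0 < eps.
Hypothesis h0 : 0 < h.
Hypothesis C0 : 0 < C.
Hypothesis Gamma0 : 0 < Gamma.
Hypothesis L_semiconcave : forall x y v z,
  L (x + y) (v - z) + L (x - y) (v + z) - 2 * L x v
    <= C * enorm y ^+ 2 + Gamma * enorm z ^+ 2.

Let alpha := C / eps.
Let gamma := Gamma / (h ^+ 2 * eps).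

(** Condition (3) with [z = (theta / h) *: y]; the factor [h ^ 2] in [gamma] comes from the square
    of [z]. *)
Lemma gibbs_kernel_forward theta x y v : 0 <= theta -> theta <= 1 ->
  gibbs_kernel eps x v ^+ 2 <=
    expR ((alpha + gamma * theta ^+ 2) * enorm y ^+ 2) *
    (gibbs_kernel eps (x + y) (v - (theta / h) *: y) *
     gibbs_kernel eps (x - y) (v + (theta / h) *: y)).
Proof.
move=> t0 t1; apply: gibbs_kernel_logconvex => //.
apply: le_trans (L_semiconcave _ _ _ _) _.
rewrite enorm_sqrZ le_eqVlt; apply/orP; left; apply/eqP.
by rewrite /alpha /gamma; field; rewrite !gt_eqF.
Qed.

(** Here the position [x - h *: v] moves with the velocity, so it is displaced only by
    [(1 - theta) *: y], and the [C] term is bounded using [(1 - theta) ^ 2 <= 1]. *)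
Lemma gibbs_kernel_backward theta x y v : 0 <= theta -> theta <= 1 ->
  gibbs_kernel eps (x - h *: v) v ^+ 2 <=
    expR ((alpha + gamma * theta ^+ 2) * enorm y ^+ 2) *
    (gibbs_kernel eps (x + y - h *: (v - (theta / - h) *: y)) (v - (theta / - h) *: y) *
     gibbs_kernel eps (x - y - h *: (v + (theta / - h) *: y)) (v + (theta / - h) *: y)).
Proof.
move=> t0 t1; set z := (theta / - h) *: y.
have hz : h *: z = - (theta *: y).
  rewrite /z scalerA invrN mulrN mulrN mulrCA divff ?gt_eqF// mulr1.
  by rewrite scaleNr.
have -> : x + y - h *: (v - z) = (x - h *: v) + (1 - theta) *: y.
  by rewrite scalerBr opprB hz scalerBl scale1r [- _ - _]addrC addrACA.
have -> : x - y - h *: (v + z) = (x - h *: v) - (1 - theta) *: y.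
  rewrite scalerDr opprD hz opprK scalerBl scale1r opprB addrACA.
  by rewrite [- y + _]addrC.
apply: gibbs_kernel_logconvex => //.
apply: le_trans (L_semiconcave _ _ _ _) _.
rewrite /z !enorm_sqrZ.
have -> : eps * ((alpha + gamma * theta ^+ 2) * enorm y ^+ 2) =
    C * enorm y ^+ 2 + Gamma * ((theta / - h) ^+ 2 * enorm y ^+ 2).
  by rewrite /alpha /gamma; field; rewrite !gt_eqF.
rewrite lerD2r ler_pM2l// ler_piMl ?enorm_sqr_ge0//.
by rewrite expr_le1// ?subr_ge0// lerBlDr lerDl.
Qed.

Definition hopf_cole (psi : 'rV[R]_n -> R) x := - (eps * h) * ln (psi x).

Lemma hopf_cole_integrand (psi : 'rV[R]_n -> R) l x : 0 < psi x ->
  expR (- ((h * l + hopf_cole psi x) / (eps * h))) = expR (- (l / eps)) * psi x.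
Proof.
move=> p0.
have -> : - ((h * l + hopf_cole psi x) / (eps * h)) = - (l / eps) + ln (psi x).
  by rewrite /hopf_cole; field; rewrite !gt_eqF.
by rewrite expRD lnK// posrE.
Qed.

Lemma hopf_cole_lipschitz (psi : 'rV[R]_n -> R) K :
  (forall x y, `|- ln (psi y) - - ln (psi x)| <= K * `|y - x|) ->
  lipschitz (hopf_cole psi).
Proof.
move=> hK; apply: (@klipschitzW _ _ _ (eps * h * K)).
  exact: (@globally_properfilter _ _ (0, 0)).
move=> [x y] _ /=; rewrite /hopf_cole.
have -> : - (eps * h) * ln (psi x) - - (eps * h) * ln (psi y) =
  (eps * h) * (- ln (psi x) - - ln (psi y)) by ring.
have eh0 : 0 < eps * h by rewrite mulr_gt0.
rewrite normrM gtr0_norm// -[leRHS]mulrA.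
by rewrite ler_pM2l.
Qed.

Lemma hopf_cole_semiconcave (psi : 'rV[R]_n -> R) sigma : h < 1 -> 0 <= sigma ->
  semiconcave sigma (fun x => - ln (psi x)) ->
  sigma ^+ 2 <= alpha * (gamma + sigma) -> semiconcave (C + Gamma) (hopf_cole psi).
Proof.
move=> h1 s0 hs hsig.
have eh0 : 0 < eps * h by rewrite mulr_gt0.
(* [S] is the modulus of [hopf_cole psi]; scaling the quadratic inequality by [(eps * h) ^ 2]
   removes [eps]. *)
pose S := eps * h * sigma.
have S0 : 0 <= S by rewrite mulr_ge0// ltW.
have SS : S ^+ 2 <= C * (Gamma + S * h).
  have -> : C * (Gamma + S * h) = (eps * h) ^+ 2 * (alpha * (gamma + sigma)).
    by rewrite /S /alpha /gamma; field; rewrite !gt_eqF.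
  by rewrite /S exprMn ler_pM2l// exprn_gt0.
have SC : S <= C + Gamma.
  rewrite leNgt; apply/negP => CS.
  have g1 : C * (S * h) <= C * S.
    by rewrite ler_pM2l// ler_piMr// ltW.
  have g2 : Gamma * C < Gamma * S by rewrite ltr_pM2l// (lt_trans _ CS)// ltrDl.
  have g3 : (C + Gamma) * S <= S * S by rewrite ler_wpM2r// ltW.
  rewrite expr2 in SS; lra.
move=> x y; apply: (@le_trans _ _ (S * enorm y ^+ 2)); last first.
  by rewrite ler_wpM2r// enorm_sqr_ge0.
have := hs x y; rewrite -(ler_pM2l eh0) /S /hopf_cole mulrA => H; lra.
Qed.

End lagrangian.

(** * Solutions of the two fixed-point equations *)

Section fixed_points.
Context {R : realType} {n : nat}.
Variable L : 'rV[R]_n -> 'rV[R]_n -> R.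
Hypothesis L_continuous : continuous (fun p : 'rV[R]_n * 'rV[R]_n => L p.1 p.2).
Hypothesis L_periodic : forall v, Zperiodic (L ^~ v).
Hypothesis L_superlinear : superlinear L.
Variables C Gamma : R.
Hypothesis C0 : 0 < C.
Hypothesis Gamma0 : 0 < Gamma.
Hypothesis L_semiconcave : forall x y v z,
  L (x + y) (v - z) + L (x - y) (v + z) - 2 * L x v
    <= C * enorm y ^+ 2 + Gamma * enorm z ^+ 2.

Lemma calG_fixed_points eps h : 0 < eps -> 0 < h ->
  exists (lambda : R) (phi phibar : 'rV[R]_n -> R),
    [/\ Zperiodic phi /\ lipschitz phi,
        Zperiodic phibar /\ lipschitz phibar,
        forall x, calG eps h L phi x = phi x + lambda &
        forall x, calGbar eps h L phibar x = phibar x + lambda] /\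
    (h < 1 -> semiconcave (C + Gamma) phi /\ semiconcave (C + Gamma) phibar).
Proof.
move=> eps0 h0; have [B hB] := superlinear_lower_bound L_continuous L_periodic L_superlinear.
pose k := gibbs_kernel L eps; pose k' x v := k (x - h *: v) v.
pose alpha := C / eps; pose gamma := Gamma / (h ^+ 2 * eps).
have alpha0 : 0 < alpha by rewrite divr_gt0.
have gamma0 : 0 < gamma by rewrite divr_gt0 ?mulr_gt0// exprn_gt0.
have hN0 : - h != 0 by rewrite oppr_eq0 gt_eqF.
have h_neq0 : h != 0 by rewrite gt_eqF.
have ieps0 : 0 < eps^-1 by rewrite invr_gt0.
have c_id : continuous (@id 'rV[R]_n) by move=> x.
have c_cst x : continuous (fun _ : 'rV[R]_n => x : 'rV[R]_n) by exact: cst_continuous.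
have kc x : continuous (k x) := gibbs_kernel_continuous L_continuous (c_cst x) c_id.
have kcx v : continuous (k ^~ v) := gibbs_kernel_continuous L_continuous c_id (c_cst v).
have kc' x : continuous (k' x).
  apply: (@gibbs_kernel_continuous _ _ L L_continuous _ (fun v => x - h *: v)) => //.
  move=> v; apply: (@continuousB R 'rV[R]_n 'rV[R]_n (fun=> x)).
    exact: cst_continuous.
  exact: scaler_continuous.
have kp v : Zperiodic (k ^~ v) by move=> x m; rewrite /k /gibbs_kernel L_periodic.
have kp' v : Zperiodic (k' ^~ v) by move=> x m; rewrite /k' addrAC kp.
have k0 x v : 0 < k x v by exact: expR_gt0.
have kM x v := gibbs_kernel_le x v eps0 hB.
have [mu [psi [mu0 [cpsi ppsi] psi0 eig [[K K0 hK] [sigma [s0 ssc hs]]]]]] :=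
  kernel_op_eigenfunction h_neq0 ieps0 alpha0 gamma0 kc kp k0 kM
    (gibbs_kernel_forward eps0 h0 L_semiconcave).
have [nu [psi' [nu0 [cpsi' ppsi'] psi'0 eig' [[K' K'0 hK'] [sigma' [s'0 ssc' hs']]]]]] :=
  kernel_op_eigenfunction hN0 ieps0 alpha0 gamma0 kc' kp'
    (fun x v => k0 (x - h *: v) v) (fun x v => kM (x - h *: v) v)
    (gibbs_kernel_backward eps0 h0 C0 L_semiconcave).
(* The eigenfunctions are built independently; equality of their eigenvalues gives one [lambda] for
   both equations. *)
have munu : mu = nu := adjoint_eigenvalues ieps0 kcx kc kc' kp k0 kM
  cpsi ppsi psi0 cpsi' ppsi' psi'0 eig eig'.
exists (- (eps * h) * ln mu), (hopf_cole eps h psi), (hopf_cole eps h psi').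
split; last first.
  move=> h1; split.
    exact: (hopf_cole_semiconcave eps0 h0 C0 Gamma0 h1 s0 ssc hs).
  exact: (hopf_cole_semiconcave eps0 h0 C0 Gamma0 h1 s'0 ssc' hs').
split.
- split; last exact: hopf_cole_lipschitz hK.
  by move=> x m; rewrite /hopf_cole ppsi.
- split; last exact: hopf_cole_lipschitz hK'.
  by move=> x m; rewrite /hopf_cole ppsi'.
- move=> x; rewrite /calG [hopf_cole _ _ _ _ in RHS]/hopf_cole -mulrDr addrC -lnM ?posrE//.
  rewrite -eig; congr (_ * ln (integral_rV _)); apply/funext => v.
  by rewrite hopf_cole_integrand.
- move=> x; rewrite /calGbar [hopf_cole _ _ _ _ in RHS]/hopf_cole munu -mulrDr addrC -lnM ?posrE//.
  rewrite -eig'; congr (_ * ln (integral_rV _)); apply/funext => v.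
  by rewrite hopf_cole_integrand// scaleNr.
Qed.

End fixed_points.

Theorem theorem1 (R : realType) (N : nat) (N_gt0 : (0 < N)%N)
    (L : 'rV[R]_N -> 'rV[R]_N -> R)
    (L_C2 : C2 (fun p : 'rV[R]_N * 'rV[R]_N => L p.1 p.2))
    (L_periodic : forall v : 'rV[R]_N, Zperiodic (fun x => L x v))
    (L_superlinear : superlinear L)
    (L_convex : forall x v : 'rV[R]_N, posdef (hessian_v L x v))
    (L_semiconcave : lagrangian_semiconcave L) :
  exists (lambda : R -> R -> R) (phi phibar : R -> R -> 'rV[R]_N -> R),
    (forall eps h : R, 0 < eps -> 0 < h ->
      [/\ Zperiodic (phi eps h) /\ lipschitz (phi eps h),
          Zperiodic (phibar eps h) /\ lipschitz (phibar eps h),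
          forall x, calG eps h L (phi eps h) x = phi eps h x + lambda eps h &
          forall x, calGbar eps h L (phibar eps h) x
                    = phibar eps h x + lambda eps h]) /\
    (exists Cbar h0 : R, 0 < h0 /\
      forall eps h : R, 0 < eps -> 0 < h -> h < h0 ->
        semiconcave Cbar (phi eps h) /\ semiconcave Cbar (phibar eps h)).
Proof.
have L_continuous : continuous (fun p : 'rV[R]_N * 'rV[R]_N => L p.1 p.2).
  by move=> p; apply: differentiable_continuous; exact: L_C2.1.1.
have [C [Gamma [C0 Gamma0 Lsc]]] := L_semiconcave.
(* Solutions and semiconcavity are bundled into one predicate, so that choice over the pairs
   [(eps, h)] selects the same functions for both claims. *)
pose P (p : R * R) (t : R * (('rV[R]_N -> R) * ('rV[R]_N -> R))) :=
  0 < p.1 -> 0 < p.2 ->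
  [/\ Zperiodic t.2.1 /\ lipschitz t.2.1, Zperiodic t.2.2 /\ lipschitz t.2.2,
      forall x, calG p.1 p.2 L t.2.1 x = t.2.1 x + t.1 &
      forall x, calGbar p.1 p.2 L t.2.2 x = t.2.2 x + t.1] /\
  (p.2 < 1 -> semiconcave (C + Gamma) t.2.1 /\ semiconcave (C + Gamma) t.2.2).
have /(@choice _ _ P) [F FP] : forall p, exists t, P p t.
  move=> [eps h]; have [eps0|eps0] := ltP 0 eps; last first.
    (* Nonpositive parameters receive zero as a default value. *)
    by exists (0, (fun=> 0, fun=> 0)); rewrite /P/= ltNge eps0.
  have [h0|h0] := ltP 0 h; last first.
    by exists (0, (fun=> 0, fun=> 0)); rewrite /P/= => _; rewrite ltNge h0.
  have [lambda [phi [phibar H]]] := calG_fixed_points L_continuous L_periodic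
    L_superlinear C0 Gamma0 Lsc eps0 h0.
  by exists (lambda, (phi, phibar)).
exists (fun eps h => (F (eps, h)).1), (fun eps h => (F (eps, h)).2.1),
  (fun eps h => (F (eps, h)).2.2); split.
  by move=> eps h eps0 h0; have [] := FP (eps, h) eps0 h0.
(* The threshold 1 is the bound on [h] under which the modulus is at most [C + Gamma]. *)
exists (C + Gamma), 1; split=> // eps h eps0 h0 h1.
by have [_] := FP (eps, h) eps0 h0; apply.
Qed.
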